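(* Let $X$ be a quasi-Banach function space over $\mathbf{R}^d$ with the Fatou property, and suppose $M:X\to X$ is bounded. Then for all $0<\theta<1$: (a) $M:(X')^\theta\to(X')^\theta$ is bounded with $\|M\|_{(X')^\theta\to(X')^\theta}\lesssim_d\frac1{1-\theta}\|M\|_{X\to X}^\theta$; (b) $M:[(X')^\theta]'\to[(X')^\theta]'$ is bounded with $\|M\|_{[(X')^\theta]'\to[(X')^\theta]'}\lesssim_d\frac1\theta\|M\|_{X\to X}$; (c) $(X')^\theta\in A_{\mathrm{sparse}}$ with $[(X')^\theta]_{A_{\mathrm{sparse}}}\lesssim_d\frac1\theta\frac1{1-\theta}\|M\|_{X\to X}^{1+\theta}$.
   Context: A quasi-Banach function space over $\mathbf{R}^d$ is a complete quasi-normed space $X\subseteq L^0(\mathbf{R}^d)$ with the ideal property (if $f\in X$, $|g|\le|f|$ then $g\in X$, $\|g\|_X\le\|f\|_X$) and the saturation property (every set of positive measure contains a subset $F$ of positive measure with $\mathbf{1}_F\in X$). Köthe dual: $\|g\|_{X'}=\sup_{\|f\|_X=1}\int|fg|$. Fatou property: $0\le f_n\uparrow f$ a.e., $\sup\|f_n\|_X<\infty$ imply $f\in X$, $\|f\|_X=\sup\|f_n\|_X$. For $0<p<\infty$, $Y^p=\{f:|f|^{1/p}\in Y\}$, $\|f\|_{Y^p}=\||f|^{1/p}\|_Y^p$. $M$ is the Hardy–Littlewood maximal operator over axis-parallel cubes. A collection $\mathcal{S}$ of cubes is sparse if there are pairwise disjoint $E_Q\subseteq Q$ with $|E_Q|\ge\frac12|Q|$;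 $Y\in A_{\mathrm{sparse}}$ means there is $C$ with $\|\sum_{Q\in\mathcal{S}}(\frac1{|Q|}\int_Q|f|)\mathbf{1}_Q\|_Y\le C\|f\|_Y$ for all sparse $\mathcal{S}$ and $f\in Y$; the least such $C$ is $[Y]_{A_{\mathrm{sparse}}}$. *)

(* Defs.v *)
From HB Require Import structures.
From mathcomp Require Import all_boot all_order all_algebra.
From mathcomp Require Import all_classical all_reals all_analysis.
From mathcomp Require Import measurable_realfun.

Set Implicit Arguments.
Unset Strict Implicit.
Unset Printing Implicit Defensive.

Import Order.TTheory GRing.Theory Num.Theory.
Import numFieldNormedType.Exports.

Local Open Scope classical_set_scope.
Local Open Scope ring_scope.
Local Open Scope ereal_scope.

Section QBFS.
Variables (R : realType) (d : nat).

(** The underlying space R^d: d-tuples of reals, with the product (= Borel)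
    sigma-algebra provided by MathComp-Analysis. *)
Definition Rd : measurableType _ := d.-tuple R.

(** A measure on R^d is the Lebesgue measure (on Borel sets) iff it gives
    every half-open box its volume; this characterizes it uniquely. *)
Definition is_lebesgue (mu : {measure set Rd -> \bar R}) : Prop :=
  forall a b : Rd, (forall i, (tnth a i <= tnth b i)%R) ->
    mu [set x : Rd | forall i, (tnth a i <= tnth x i < tnth b i)%R]
    = (\prod_(i < d) (tnth b i - tnth a i))%:E.

Definition cube (a : Rd) (l : R) : set Rd :=
  [set x : Rd | forall i, (tnth a i <= tnth x i <= tnth a i + l)%R].

Variable mu : {measure set Rd -> \bar R}.

(** A (quasi-)function norm is modelled as an extended-real valued functional
    on real functions; the space it defines consists of the measurable
    functions with finite norm. *)
Definition fnorm := (Rd -> R) -> \bar R.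

Definition inspace (N : fnorm) (f : Rd -> R) : Prop :=
  measurable_fun setT f /\ N f < +oo.

Definition is_qBfs (N : fnorm) : Prop :=
      (forall f, 0 <= N f) /\
      (forall f, inspace N f -> (N f = 0 <-> {ae mu, forall x, f x = 0%R})) /\
      (* absolute homogeneity (and closure under scalar multiplication) *)
      (forall f (c : R), inspace N f ->
         N (fun x => c * f x)%R = (`|c|)%:E * N f) /\
      (* quasi-triangle inequality (and closure under addition) *)
      (exists K : R, (1 <= K)%R /\ forall f g, inspace N f -> inspace N g ->
         N (fun x => f x + g x)%R <= K%:E * (N f + N g)) /\
      (forall u : nat -> Rd -> R, (forall n, inspace N (u n)) ->
         (forall eps : R, (0 < eps)%R -> exists M : nat, forall m n,
            (M <= m)%N -> (M <= n)%N -> N (fun x => u m x - u n x)%R < eps%:E) ->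
         exists f, inspace N f /\ (N (fun x => u n x - f x)%R @[n --> \oo] --> 0)) /\
      (forall f (g : Rd -> R), inspace N f -> measurable_fun setT g ->
         {ae mu, forall x, (`|g x| <= `|f x|)%R} -> inspace N g /\ N g <= N f) /\
      (forall E, measurable E -> 0 < mu E -> exists F, [/\ measurable F,
          F `<=` E, 0 < mu F & inspace N (\1_F : Rd -> R)]).

Definition fatou_property (N : fnorm) : Prop :=
  forall (fn : nat -> Rd -> R) (f : Rd -> R),
    (forall n, measurable_fun setT (fn n)) -> measurable_fun setT f ->
    {ae mu, forall x, (forall n, 0 <= fn n x)%R /\ (forall n, fn n x <= fn n.+1 x)%R
                      /\ (fn n x @[n --> \oo] --> f x)} ->
    (exists B : R, forall n, N (fn n) <= B%:E) ->
    inspace N f /\ N f = ereal_sup (range (fun n => N (fn n))).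

Definition kothe (N : fnorm) : fnorm := fun g =>
  ereal_sup [set \int[mu]_x (`|f x * g x|)%:E | f in [set f | inspace N f /\ N f = 1]].

Definition fpower (N : fnorm) (p : R) : fnorm := fun f =>
  poweR (N (fun x => `|f x| `^ p^-1)%R) p.

Definition avg (Q : set Rd) (f : Rd -> R) : \bar R :=
  ((fine (mu Q))^-1)%:E * \int[mu]_(y in Q) (`|f y|)%:E.

Definition maximal_cube (f : Rd -> R) : Rd -> \bar R := fun x =>
  ereal_sup [set avg (cube al.1 al.2) f | al in
               [set al : Rd * R | (0 < al.2)%R /\ cube al.1 al.2 x]].

Definition in_with_norm (N : fnorm) (h : Rd -> \bar R) (K : \bar R) : Prop :=
  [/\ measurable_fun setT h, {ae mu, forall x, h x \is a fin_num} &
      N (fun x => fine (h x)) <= K].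

Definition bounded_with (N : fnorm) (T : (Rd -> R) -> Rd -> \bar R) (C : R) :=
  forall f, inspace N f -> in_with_norm N (T f) (C%:E * N f).

Definition opnorm (N : fnorm) (T : (Rd -> R) -> Rd -> \bar R) : \bar R :=
  ereal_inf [set C%:E | C in [set C : R | (0 <= C)%R /\ bounded_with N T C]].

Definition sparse (S : set (Rd * R)) : Prop :=
  (forall al, S al -> (0 < al.2)%R) /\
  exists E : Rd * R -> set Rd,
    [/\ (forall al, S al -> measurable (E al) /\ E al `<=` cube al.1 al.2),
        (forall al be, S al -> S be -> al <> be -> E al `&` E be = set0) &
        (forall al, S al -> mu (cube al.1 al.2) <= 2%:E * mu (E al))].

Definition sparse_op (S : set (Rd * R)) (f : Rd -> R) : Rd -> \bar R :=
  fun x => \esum_(al in S) (avg (cube al.1 al.2) f * (\1_(cube al.1 al.2) x : R)%:E).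

(** [Y]_{A_sparse}: least admissible constant (+oo if Y is not in A_sparse). *)
Definition Asparse_const (N : fnorm) : \bar R :=
  ereal_inf [set C%:E | C in [set C : R | (0 <= C)%R /\
     forall S, sparse S -> bounded_with N (sparse_op S) C]].

End QBFS.

(* Main.v *)
(* Write X' for the Koethe dual, m for the norm of M on X, r = 1/theta, s = r - 1.
   All cubes are first replaced by cells of 2^d shifted triadic grids, in which
   finite families are nested; duality with X then reduces everything to integral
   inequalities against h in X with Mh as the majorant of the averages of h.
   (a) is a Fefferman-Stein inequality: a Doob-type telescoping along the chain of
   cells containing a point, together with <f>_Q <= 2 <f 1_{2f >= <f>_Q}>_Q, gives
   int (Mf)^r h <= C^r r/s int f^r Mh.
   (b) Linearize Mf = sum <f>_{Q_i} 1_{E_i} with disjoint E_i; the adjoint is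
   A g = sum (1/|Q_i| int_{E_i} g) 1_{Q_i}, and nestedness yields the pointwise
   bound (A g)^r <= r A(g (A g)^s), hence |(A g)^r| <= r m |g (A g)^s| in X', so
   that |A g| <= C r m |g| in (X')^theta.
   (c) For a sparse family <f>_Q <= (2/|Q|) int_{E_Q} Mf, so the sparse operator is
   dominated by A(Mf), to which (b) and (a) apply. *)
Require Import Defs.
From HB Require Import structures.
From mathcomp Require Import all_boot all_order all_algebra.
From mathcomp Require Import all_classical all_reals all_analysis.
From mathcomp Require Import measurable_realfun.
From mathcomp Require Import ring lra.
Import Order.TTheory GRing.Theory Num.Theory.
Import numFieldNormedType.Exports.
Local Open Scope classical_set_scope.
Local Open Scope ring_scope.
Local Open Scope ereal_scope.

Set Implicit Arguments.
Unset Strict Implicit.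
Unset Printing Implicit Defensive.

(** Everything is estimated for r-th powers in X', and the power theta is applied only at the end: a
    constant B becomes B^theta, so 2^r r/s m yields at most 2 m^theta / (1 - theta), and (2 r m)^r
    yields 2 r m. Factors that are at least 1, such as 2^d, are first bounded by their r-th power,
    so that they survive the root unchanged. The absorption in (b) moves half of |(A g)^r| to the
    left-hand side, hence this norm must be finite beforehand. That forces finite families;
    finiteness then rests on indicators of cubes having finite norm in X', itself a consequence of
    the boundedness of M on X. The passage to all cells is monotone convergence in the integrals
    against a fixed test function. M f and the sparse sums may a priori be infinite, whereas norms
    act on real functions. The bounds are therefore proved for every real psi below them, and
    finiteness almost everywhere is deduced from these bounds. A cube of side l lies in a cell of
    side at most 6 l, whence the powers of 6^d; counting the grids gives the powers of 2^d. *)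

(** * Power inequalities for telescoping and absorption *)

Section power_inequalities.
Variables (R : realType) (s : R).
Hypothesis s0 : (0 < s)%R.
Local Open Scope ring_scope.
Implicit Types x y a b : R.

(** Young's inequality with conjugate exponents [s + 1] and [(s + 1) / s], applied to x and y^s and
    cleared of denominators. *)
Lemma young_powR x y : 0 <= x -> 0 <= y ->
  (s + 1) * x * y `^ s <= x `^ (s + 1) + s * y `^ (s + 1).
Proof.
move=> x0 y0.
have p0 : 0 < s + 1 by rewrite addr_gt0.
have sn0 : s != 0 by rewrite gt_eqF.
have pn0 : s + 1 != 0 by rewrite gt_eqF.
have := @conjugate_powR R x (y `^ s) (s + 1) ((s + 1) / s) x0 (powR_ge0 _ _) p0
  (divr_gt0 p0 s0).
rewrite -powRrM mulrCA divff// mulr1 invf_div => /(_ _)/wrap[].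
  by field.
rewrite -(ler_pM2l p0) => /le_trans; rewrite -mulrA; apply.
rewrite le_eqVlt; apply/orP; left; apply/eqP.
by field; rewrite ?pn0 ?sn0.
Qed.

Lemma powRS x : 0 <= x -> x `^ (s + 1) = x * x `^ s.
Proof.
move=> x0; rewrite -(@mulr_powRB1 R x (s + 1))//; last by rewrite addr_gt0.
by congr (_ * _ `^ _); ring.
Qed.

(** Convexity: t^(s+1) lies above its tangent at b. No order between a and b is assumed. *)
Lemma powR_sub_le_right a b : 0 <= a -> 0 <= b ->
  b `^ (s + 1) - a `^ (s + 1) <= (s + 1) * (b - a) * b `^ s.
Proof.
by move=> a0 b0; have := @young_powR a b a0 b0; rewrite (@powRS b)//; have h := s0; nra.
Qed.

(** Discrete form of d(t^r) = (r/s) t d(t^s) with r = s + 1; this is where the Doob constant r/s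
    originates. *)
Lemma powR_sub_le_doob a b : 0 <= a -> 0 <= b ->
  b `^ (s + 1) - a `^ (s + 1) <= (s + 1) / s * (b * (b `^ s - a `^ s)).
Proof.
move=> a0 b0; have := @young_powR b a b0 a0.
rewrite (@powRS b)// => yg; rewrite mulrAC ler_pdivlMr//; have h := s0; nra.
Qed.

(** Either x <= e y, and the first term suffices, or y < x / e, and the second does. The free
    parameter e is later chosen small enough to absorb the first term. *)
Lemma mul_powR_le_split x y e : 0 < e -> 0 <= x -> 0 <= y ->
  x * y `^ s <= e * y `^ (s + 1) + e^-1 `^ s * x `^ (s + 1).
Proof.
move=> e0 x0 y0; have [xy|yx] := leP x (e * y).
  rewrite (@powRS y)// -[leLHS]addr0 lerD ?mulr_ge0 ?powR_ge0//.
  by rewrite mulrA ler_wpM2r ?powR_ge0.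
rewrite (@powRS x)// -[leLHS]add0r lerD//.
  by rewrite mulr_ge0 ?powR_ge0// ltW.
rewrite mulrCA ler_wpM2l// -powRM ?invr_ge0 ?(ltW e0)//.
by rewrite ge0_ler_powR ?nnegrE ?mulr_ge0 ?invr_ge0 ?(ltW e0) ?(ltW s0)// mulrC
  ler_pdivlMr// mulrC ltW.
Qed.

End power_inequalities.

(** * Monotone limits and averages in integrals *)

Section integral_tools.
Context d (T : measurableType d) (R : realType).
Variable mu : {measure set T -> \bar R}.

Lemma ge0_integral_mulindic (D : set T) (h : T -> \bar R) : measurable D ->
  \int[mu]_x ((\1_D x : R)%:E * h x) = \int[mu]_(x in D) h x.
Proof.
move=> mD; rewrite [RHS]integral_mkcond; apply: eq_integral => x _.
by rewrite patchE indicE; case: ifP => _; rewrite ?mul1e ?mul0e.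
Qed.

Lemma ge0_integral_sum_indic n (c : nat -> R) (Q : nat -> set T)
    (h : T -> \bar R) :
  (forall k, 0 <= c k)%R -> (forall k, measurable (Q k)) ->
  measurable_fun setT h -> (forall x, 0 <= h x) ->
  \int[mu]_x (\sum_(k < n) (c k * \1_(Q k) x)%:E * h x) =
  \sum_(k < n) (c k)%:E * \int[mu]_(x in Q k) h x.
Proof.
move=> c0 mQ mh h0; rewrite ge0_integral_sum//; last 2 first.
  move=> k; apply: emeasurable_funM => //.
  by apply/measurable_EFinP; exact: measurable_funM.
  by move=> k x _; rewrite mule_ge0// lee_fin mulr_ge0.
apply: eq_bigr => k _; rewrite -(ge0_integral_mulindic h (mQ k)).
rewrite -ge0_integralZl ?lee_fin//.
- by apply: eq_integral => x _; rewrite EFinM muleA.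
- by apply: emeasurable_funM => //; apply/measurable_EFinP.
- by move=> x _; rewrite mule_ge0// lee_fin.
Qed.

(** Carries bounds for finite families over to full operators: by monotone convergence it is enough
    that each value of [phi] is reached by some [g n], with n depending on the point. *)
Lemma integral_le_of_eventually (phi : T -> \bar R) (g : nat -> T -> \bar R)
    (B : \bar R) :
  measurable_fun setT phi -> (forall x, 0 <= phi x) ->
  (forall n, measurable_fun setT (g n)) -> (forall n x, 0 <= g n x) ->
  (forall x, {homo g ^~ x : m n / (m <= n)%N >-> m <= n}) ->
  (forall x, exists n, phi x <= g n x) ->
  (forall n, \int[mu]_x g n x <= B) ->
  \int[mu]_x phi x <= B.
Proof.
move=> mphi phi0 mg g0 ndg phig gB.
have cg x : cvgn (g ^~ x) by exact: ereal_nondecreasing_is_cvgn.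
apply: (@le_trans _ _ (\int[mu]_x limn (g ^~ x))).
  apply: ge0_le_integral => //.
    by apply: (emeasurable_fun_cvg g) => // x _; exact: cg.
  move=> x _; have [n /le_trans] := phig x; apply.
  rewrite (cvg_lim _ (ereal_nondecreasing_cvgn (ndg x)))//.
  by apply: ereal_sup_ubound; exists n.
rewrite monotone_convergence//.
apply: lime_le => //; last exact: nearW.
apply: ereal_nondecreasing_is_cvgn => m n mn.
by apply: ge0_le_integral => // x _; exact: ndg.
Qed.

(** The average of h over Q is a constant below H on E, so it may be moved inside the integral of g
    over E. *)
Lemma average_duality (E Q : set T) (g h : T -> R) (H : T -> \bar R) (w : R) :
  measurable E -> E `<=` Q -> (0 < w)%R ->
  measurable_fun setT g -> (forall x, 0 <= g x)%R ->
  (forall x, 0 <= h x)%R -> measurable_fun setT H ->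
  (forall x, Q x -> (w^-1)%:E * \int[mu]_(y in Q) (h y)%:E <= H x) ->
  (w^-1)%:E * (\int[mu]_(x in E) (g x)%:E * \int[mu]_(y in Q) (h y)%:E) <=
  \int[mu]_(x in E) ((g x)%:E * H x).
Proof.
move=> mE EQ w0 mg g0 h0 mH hH.
have J0 : 0 <= (w^-1)%:E * \int[mu]_(y in Q) (h y)%:E.
  by rewrite mule_ge0 ?lee_fin ?invr_ge0 ?(ltW w0)// integral_ge0// => y _; rewrite lee_fin.
rewrite muleCA -ge0_integralZr//; last 2 first.
- exact/measurable_EFinP/measurable_funTS.
- by move=> x _; rewrite lee_fin.
apply: ge0_le_integral => //.
- by move=> x _; rewrite mule_ge0// lee_fin.
- by apply: emeasurable_funM => //; exact/measurable_EFinP/measurable_funTS.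
- apply: emeasurable_funM; first exact/measurable_EFinP/measurable_funTS.
  exact: measurable_funTS.
- by move=> x Ex; rewrite lee_wpmul2l ?lee_fin//; exact/hH/EQ.
Qed.

End integral_tools.

(** * Sums and maxima over a finite nested family *)

Section nested.
Context d (T : measurableType d) (R : realType).
Variable mu : {measure set T -> \bar R}.
Variables (n : nat) (Q : nat -> set T) (w : nat -> R).
Hypothesis mQ : forall k, measurable (Q k).
Hypothesis nestedQ : forall i j, (i < j < n)%N ->
  Q j `<=` Q i \/ Q i `&` Q j = set0.
Hypothesis w0 : forall k, (0 < w k)%R.
Variables (h : T -> R) (H : T -> \bar R).
Hypothesis h0 : forall x, (0 <= h x)%R.
Hypothesis mh : measurable_fun setT h.
Hypothesis mH : measurable_fun setT H.
Hypothesis H0 : forall x, 0 <= H x.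
Hypothesis hH : forall k x, (k < n)%N -> Q k x ->
  ((w k)^-1)%:E * \int[mu]_(y in Q k) (h y)%:E <= H x.
Variable s : R.
Hypothesis s0 : (0 < s)%R.

(** An earlier set either contains [Q k] or misses it. Hence partial sums and running maxima up to
    index k are constant on [Q k], which is all that nestedness is used for. *)
Lemma nested_indic i k x y : (i <= k < n)%N -> Q k x -> Q k y ->
  \1_(Q i) x = \1_(Q i) y :> R.
Proof.
move=> /andP[]; rewrite leq_eqVlt => /predU1P[-> _ Qx Qy|ik kn Qx Qy].
  by rewrite !indicE !mem_set.
have [QQ|Q0] := nestedQ (introT andP (conj ik kn)).
  by rewrite !indicE !mem_set//; exact: QQ.
rewrite !indicE !memNset// => Qi.
  by have : set0 y by rewrite -Q0.
by have : set0 x by rewrite -Q0.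
Qed.

Definition psum (a : nat -> R) k x := (\sum_(i < k) a i * \1_(Q i) x)%R.

Lemma psumS a k x : psum a k.+1 x = (psum a k x + a k * \1_(Q k) x)%R.
Proof. by rewrite /psum big_ord_recr. Qed.

Lemma psum_ge0 a k x : (forall i, 0 <= a i)%R -> (0 <= psum a k x)%R.
Proof. by move=> a0; apply: sumr_ge0 => i _; rewrite mulr_ge0. Qed.

Lemma le_psum a j k x : (forall i, 0 <= a i)%R -> (j <= k)%N ->
  (psum a j x <= psum a k x)%R.
Proof.
move=> a0; elim: k => [|k ih]; first by rewrite leqn0 => /eqP ->.
rewrite leq_eqVlt => /predU1P[->//|jk]; rewrite psumS.
by rewrite (le_trans (ih jk))// lerDl mulr_ge0.
Qed.

Lemma measurable_psum a k : measurable_fun setT (psum a k).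
Proof. by apply: measurable_sum => i; exact: measurable_funM. Qed.

Lemma psum_nested a k x y : (k < n)%N -> Q k x -> Q k y ->
  psum a k.+1 x = psum a k.+1 y.
Proof.
move=> kn Qx Qy; apply: eq_bigr => i _; congr (_ * _)%R.
by apply: (@nested_indic i k); rewrite // kn andbT -ltnS.
Qed.

(** Telescoping in k, with each increment bounded by the tangent inequality. The power is taken of
    the sum that already includes the k-th term, the one that is constant on [Q k]. *)
Lemma powR_psum_le a x : (forall i, 0 <= a i)%R ->
  (psum a n x `^ (s + 1) <=
   \sum_(k < n) (s + 1) * a k * psum a k.+1 x `^ s * \1_(Q k) x)%R.
Proof.
move=> a0; elim: (n) => [|k ih].
  by rewrite /psum !big_ord0 powR0// gt_eqF// addr_gt0.
rewrite big_ord_recr/=; apply: le_trans (lerD ih (lexx _)).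
have := powR_sub_le_right s0 (psum_ge0 k x a0) (psum_ge0 k.+1 x a0).
rewrite lerBlDl => /le_trans; apply.
rewrite lerD2l// {1}psumS (addrC (psum a k x)) addrK.
by rewrite le_eqVlt; apply/orP; left; apply/eqP; ring.
Qed.

Lemma nested_sum_bound (E : nat -> set T) (g : T -> R) (a : nat -> R) :
  (forall k, measurable (E k)) -> (forall k, (k < n)%N -> E k `<=` Q k) ->
  (forall i j, (i < n)%N -> (j < n)%N -> i <> j -> E i `&` E j = set0) ->
  measurable_fun setT g -> (forall x, 0 <= g x)%R -> (forall k, 0 <= a k)%R ->
  (forall k, (k < n)%N -> \int[mu]_(x in E k) (g x)%:E = (w k * a k)%:E) ->
  \int[mu]_x (psum a n x `^ (s + 1) * h x)%:E <=
  (s + 1)%:E * \int[mu]_x ((g x * psum a n x `^ s)%:E * H x).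
Proof.
move=> mE EQ Edisj mg g0 a0 aE.
have s1 : (0 <= s + 1)%R by rewrite addr_ge0// ltW.
(* [C k] is the constant value on [Q k] of the s-th power of the partial sum, and 0 when [Q k] is
   empty. Being constant, it leaves the integral over [Q k] and later enters the one over [E k]. *)
have /choice[C CP] : forall k, exists c : R, (0 <= c)%R /\
    forall x, (k < n)%N -> Q k x -> (psum a k.+1 x `^ s = c)%R.
  move=> k; have [[x0 Qx0]|Q0] := pselect (exists x, Q k x).
    exists (psum a k.+1 x0 `^ s)%R; split; first exact: powR_ge0.
    by move=> x kn Qx; congr (_ `^ _)%R; exact: psum_nested Qx Qx0.
  by exists 0%R; split=> // x _ Qx; exfalso; apply: Q0; exists x.
have C0 k : (0 <= C k)%R by case: (CP k).
apply: (@le_trans _ _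
    (\int[mu]_x \sum_(k < n) ((s + 1) * a k * C k * \1_(Q k) x)%:E * (h x)%:E)).
  apply: ge0_le_integral => //.
  - by move=> x _; rewrite lee_fin mulr_ge0// powR_ge0.
  - apply/measurable_EFinP/measurable_funM => //.
    exact: measurableT_comp (measurable_powR _) (measurable_psum _ _).
  - apply: emeasurable_sum => k; apply: emeasurable_funM; last exact/measurable_EFinP.
    by apply/measurable_EFinP; exact: measurable_funM.
  - move=> x _; rewrite -ge0_sume_distrl; last first.
      by move=> k _; rewrite lee_fin !mulr_ge0.
    rewrite sumEFin -EFinM lee_fin ler_wpM2r//.
    apply: (le_trans (powR_psum_le _ a0)).
    apply: ler_sum => k _; rewrite !indicE.
    by case: (boolP (x \in Q k)); rewrite ?mulr0// inE => Qx; rewrite (CP k).2.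
rewrite (ge0_integral_sum_indic mu n (c := fun k => (s + 1) * a k * C k)%R)//;
  last 2 first.
- by move=> k; rewrite !mulr_ge0.
- exact/measurable_EFinP.
apply: (@le_trans _ _ ((s + 1)%:E *
    \sum_(k < n) (C k)%:E * \int[mu]_(x in E k) ((g x)%:E * H x))).
  rewrite ge0_sume_distrr; last first.
    move=> k _; rewrite mule_ge0 ?lee_fin// integral_ge0// => x _.
    by rewrite mule_ge0// lee_fin.
  apply: lee_sum => k _.
  have -> : ((s + 1) * a k * C k)%:E = (s + 1)%:E * ((C k)%:E * (a k)%:E).
    by rewrite -!EFinM; congr (_%:E); ring.
  rewrite -!muleA lee_wpmul2l ?lee_fin// lee_wpmul2l ?lee_fin//.
  apply: le_trans (average_duality (mE k) (EQ k (ltn_ord k)) (w0 k) mg g0 h0 mH _).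
    rewrite aE// muleA -EFinM mulKf// gt_eqF//.
  by move=> x; exact: hH.
rewrite lee_wpmul2l ?lee_fin//.
rewrite -(ge0_integral_sum_indic mu n C0 mE)//; last 2 first.
- by apply: emeasurable_funM => //; exact/measurable_EFinP.
- by move=> x; rewrite mule_ge0// lee_fin.
apply: ge0_le_integral => //.
- move=> x _; apply: sume_ge0 => k _; rewrite mule_ge0 ?lee_fin ?mulr_ge0//.
  by rewrite mule_ge0// lee_fin.
- apply: emeasurable_sum => k; apply: emeasurable_funM.
    by apply/measurable_EFinP; exact: measurable_funM.
  by apply: emeasurable_funM => //; exact/measurable_EFinP.
- apply: emeasurable_funM => //; apply/measurable_EFinP/measurable_funM => //.
  exact: measurableT_comp (measurable_powR _) (measurable_psum _ _).
move=> x _; rewrite -ge0_sume_distrl; last first.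
  by move=> k _; rewrite lee_fin mulr_ge0.
rewrite muleA lee_wpmul2r// sumEFin -EFinM lee_fin mulrC ler_wpM2l//.
(* By disjointness at most one term survives at x, and its [C k] is the s-th power of a partial sum,
   hence at most that of the full sum. *)
have [[k Ekx]|nE] := pselect (exists k : 'I_n, E k x).
  rewrite (bigD1 k)//= big1 ?addr0; last first.
    move=> i /eqP ik; rewrite indicE memNset ?mulr0// => Eix.
    suff : set0 x by [].
    rewrite -(Edisj i k)// => ik'; apply: ik; exact: val_inj.
  rewrite indicE mem_set// mulr1 -((CP k).2 x) ?ltn_ord//; last exact: EQ.
  by rewrite ge0_ler_powR ?nnegrE ?psum_ge0// ?(ltW s0)// le_psum.
rewrite big1 ?powR_ge0// => k _; rewrite indicE memNset ?mulr0// => Ekx.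
by apply: nE; exists k.
Qed.


Fixpoint pmax (b : nat -> R) k x : R :=
  if k is k'.+1 then Num.max (pmax b k' x) (b k' * \1_(Q k') x)%R else 0%R.

Lemma pmax_ge0 b k x : (0 <= pmax b k x)%R.
Proof. by elim: k => //= k ih; rewrite le_max ih. Qed.

Lemma measurable_pmax b k : measurable_fun setT (pmax b k).
Proof.
elim: k => [|k ih] /=; first exact: measurable_cst.
by apply: measurable_maxr => //; exact: measurable_funM.
Qed.

Lemma le_pmax b j k x : (j <= k)%N -> (pmax b j x <= pmax b k x)%R.
Proof.
elim: k => [|k ih]; first by rewrite leqn0 => /eqP ->.
rewrite leq_eqVlt => /predU1P[->//|jk] /=.
by rewrite le_max ih.
Qed.

Lemma pmax_ge b i k x : (i < k)%N -> (b i * \1_(Q i) x <= pmax b k x)%R.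
Proof. by move=> /(le_pmax b x); apply: le_trans; rewrite /= le_max lexx orbT. Qed.

Lemma pmax_nested b k j x y : (j <= k.+1)%N -> (k < n)%N -> Q k x -> Q k y ->
  pmax b j x = pmax b j y.
Proof.
move=> + kn Qx Qy; elim: j => //= j ih jk; rewrite ih ?(ltnW jk)//.
by congr (Num.max _ (_ * _))%R; apply: (@nested_indic j k); rewrite // kn andbT -ltnS.
Qed.

Lemma pmaxS b k x : (0 <= b k)%R ->
  pmax b k.+1 x = if x \in Q k then Num.max (pmax b k x) (b k) else pmax b k x.
Proof.
move=> bk0 /=; rewrite indicE; case: ifP => _; first by rewrite mulr1.
by rewrite mulr0 max_l ?pmax_ge0.
Qed.

(** The maximum changes at step k only if it jumps to [b k] on [Q k]; then the Doob-type inequality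
    applies with [b k] as the larger value. *)
Lemma powR_pmax_le (b : nat -> R) x : (forall i, 0 <= b i)%R ->
  (pmax b n x `^ (s + 1) <=
   \sum_(k < n) (s + 1) / s *
     (b k * (pmax b k.+1 x `^ s - pmax b k x `^ s)) * \1_(Q k) x)%R.
Proof.
move=> b0; elim: (n) => [|k ih].
  by rewrite big_ord0 /= powR0// gt_eqF// addr_gt0.
rewrite big_ord_recr; apply: le_trans (lerD ih (lexx _)).
rewrite -lerBlDl pmaxS// indicE; case: ifP => _; last by rewrite mulr0 subrr.
rewrite mulr1; have [bk|bk] := leP (b k) (pmax b k x).
  by rewrite !subrr !mulr0.
by apply: powR_sub_le_doob => //; exact: pmax_ge0.
Qed.

(** A jump to a value [b k <= v] is also a jump of the maximum truncated at v, so the selected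
    increments telescope inside the truncated maximum. *)
Lemma telescope_pmax_le (b : nat -> R) x (v : R) : (forall i, 0 <= b i)%R -> (0 <= v)%R ->
  (\sum_(k < n) (if (b k <= v)%R then
      (pmax b k.+1 x `^ s - pmax b k x `^ s) * \1_(Q k) x else 0) <= v `^ s)%R.
Proof.
move=> b0 v0.
apply: (@le_trans _ _ (Num.min (pmax b n x) v `^ s)%R); last first.
  by rewrite ge0_ler_powR ?nnegrE ?le_min ?pmax_ge0// ?(ltW s0)// ge_min lexx orbT.
elim: (n) => [|k ih]; first by rewrite big_ord0 powR_ge0.
rewrite big_ord_recr; apply: (le_trans (lerD ih (lexx _))).
have mono : (Num.min (pmax b k x) v `^ s <= Num.min (pmax b k.+1 x) v `^ s)%R.
  rewrite ge0_ler_powR ?nnegrE ?le_min ?pmax_ge0// ?(ltW s0)//.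
  by rewrite !ge_min lexx orbT le_pmax.
case: ifPn => [bkv|_]; last by rewrite addr0.
rewrite indicE; case: (boolP (x \in Q k)) => [xQ|_]; last by rewrite mulr0 addr0.
rewrite mulr1; move: mono; rewrite pmaxS// xQ.
have [bk|bk] := leP (b k) (pmax b k x); first by rewrite subrr addr0.
by rewrite min_l ?(le_trans (ltW bk) bkv)// min_l// addrC subrK.
Qed.

(** Of the factor 2^(s+1), one 2 pays for restricting each average to the set where
    [b k <= 2 * f x], and 2^s comes from telescoping up to the level 2 f. *)
Lemma nested_max_bound (f : T -> R) (b : nat -> R) :
  measurable_fun setT f -> (forall x, 0 <= f x)%R -> (forall k, 0 <= b k)%R ->
  (forall k, (k < n)%N -> mu (Q k) = (w k)%:E) ->
  (forall k, (k < n)%N -> \int[mu]_(x in Q k) (f x)%:E = (w k * b k)%:E) ->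
  \int[mu]_x (pmax b n x `^ (s + 1) * h x)%:E <=
  (2 `^ (s + 1) * ((s + 1) / s))%:E * \int[mu]_x ((f x `^ (s + 1))%:E * H x).
Proof.
move=> mf f0 b0 muQ bQ.
have s1 : (0 <= (s + 1) / s)%R by rewrite divr_ge0 ?addr_ge0// ltW.
(* [C k] is the increment of the s-th power of the running maximum at step k, constant on [Q k]. *)
have /choice[C CP] : forall k, exists c : R, (0 <= c)%R /\ forall x, (k < n)%N ->
    Q k x -> (pmax b k.+1 x `^ s - pmax b k x `^ s = c)%R.
  move=> k; have [[x0 Qx0]|Q0] := pselect (exists x, Q k x).
    exists (pmax b k.+1 x0 `^ s - pmax b k x0 `^ s)%R; split.
      by rewrite subr_ge0 ge0_ler_powR ?nnegrE ?pmax_ge0 ?(ltW s0) ?le_pmax.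
    move=> x kn Qx.
    by rewrite (pmax_nested b (leqnn _) kn Qx Qx0) (pmax_nested b (leqnSn _) kn Qx Qx0).
  by exists 0%R; split=> // x _ Qx; exfalso; apply: Q0; exists x.
have C0 k : (0 <= C k)%R by case: (CP k).
pose B k := [set x | (b k <= 2 * f x)%R].
have mB k : measurable (B k).
  rewrite -[B k]setTI; apply: (measurable_fun_ler _ _) => //.
  exact: measurable_funM.
have mQB k : measurable (Q k `&` B k) by exact: measurableI.
have mfH : measurable_fun setT (fun x => (f x)%:E * H x).
  by apply: emeasurable_funM => //; exact/measurable_EFinP.
have fH0 x : 0 <= (f x)%:E * H x by rewrite mule_ge0// lee_fin.
apply: (@le_trans _ _ (\int[mu]_x
    \sum_(k < n) ((s + 1) / s * (b k * C k) * \1_(Q k) x)%:E * (h x)%:E)).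
  apply: ge0_le_integral => //.
  - by move=> x _; rewrite lee_fin mulr_ge0// powR_ge0.
  - apply/measurable_EFinP/measurable_funM => //.
    exact: measurableT_comp (measurable_powR _) (measurable_pmax _ _).
  - apply: emeasurable_sum => k; apply: emeasurable_funM; last exact/measurable_EFinP.
    by apply/measurable_EFinP; exact: measurable_funM.
  - move=> x _; rewrite -ge0_sume_distrl; last first.
      by move=> k _; rewrite lee_fin mulr_ge0// mulr_ge0// mulr_ge0.
    rewrite sumEFin -EFinM lee_fin ler_wpM2r//.
    apply: (le_trans (powR_pmax_le _ b0)).
    apply: ler_sum => k _; rewrite !indicE.
    by case: (boolP (x \in Q k)); rewrite ?mulr0// inE => Qx; rewrite (CP k).2.
rewrite (ge0_integral_sum_indic mu n (c := fun k => (s + 1) / s * (b k * C k))%R)//;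
  last 2 first.
- by move=> k; rewrite mulr_ge0// mulr_ge0.
- exact/measurable_EFinP.
apply: (@le_trans _ _ ((2 * ((s + 1) / s))%:E *
    \sum_(k < n) (C k)%:E * \int[mu]_(x in Q k `&` B k) ((f x)%:E * H x))).
  rewrite ge0_sume_distrr; last first.
    by move=> k _; rewrite mule_ge0 ?lee_fin// integral_ge0.
  apply: lee_sum => k _; have kn := ltn_ord k.
  have -> : ((s + 1) / s * (b k * C k))%:E =
      (2 * ((s + 1) / s))%:E * ((C k)%:E * (b k / 2)%:E).
    by rewrite -!EFinM; congr (_%:E); field; rewrite gt_eqF.
  rewrite -!muleA; apply: lee_wpmul2l; first by rewrite lee_fin mulr_ge0.
  apply: lee_wpmul2l; first by rewrite lee_fin.
  have half : (w k * (b k / 2))%:E <= \int[mu]_(x in Q k `&` B k) (f x)%:E.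
    (* Off [B k] one has f < b k / 2, so that part contributes at most half of the total
       [w k * b k]. *)
    have split_ : \int[mu]_(x in Q k) (f x)%:E <=
        \int[mu]_(x in Q k `&` B k) (f x)%:E + (w k * (b k / 2))%:E.
      have mQDB : measurable (Q k `\` B k) by exact: measurableD.
      rewrite -[X in \int[mu]_(x in X) _ <= _](setUIDK (Q k) (B k)).
      rewrite ge0_integral_setU//; last 3 first.
      - exact/measurable_EFinP/measurable_funTS.
      - by move=> x _; rewrite lee_fin.
      - by apply/disj_setPS => x [[_ +] [_]].
      rewrite leeD2l//.
      apply: (@le_trans _ _ (\int[mu]_(x in Q k `\` B k) (b k / 2)%:E)).
        apply: ge0_le_integral => //.
        - by move=> x _; rewrite lee_fin.
        - exact/measurable_EFinP/measurable_funTS.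
        - by move=> x [_ /negP]; rewrite -ltNge lee_fin => bk; lra.
      rewrite integral_cst// [(w k * _)%R]mulrC [leRHS]EFinM.
      apply: lee_wpmul2l; first by rewrite lee_fin divr_ge0.
      by rewrite -muQ// le_measure ?inE//; exact: subDsetl.
    move: split_; rewrite bQ//.
    rewrite -leeBlDr// -EFinB => /(le_trans _); apply.
    by rewrite lee_fin; lra.
  apply: le_trans (average_duality (mQB k) (@subIsetl _ _ _) (w0 k) mf f0 h0 mH _).
    rewrite muleA lee_wpmul2r ?integral_ge0//.
      by move=> x _; rewrite lee_fin.
    rewrite -(@lee_pmul2l _ (w k)%:E) ?lte_fin//.
    by rewrite muleA -!EFinM divff ?gt_eqF// mul1e.
  by move=> x; exact: hH.
rewrite -(ge0_integral_sum_indic mu n C0 mQB)//.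
have mpow r : measurable_fun setT (fun x => f x `^ r)%R.
  exact: measurableT_comp (measurable_powR _) mf.
apply: (@le_trans _ _ ((2 * ((s + 1) / s))%:E *
    \int[mu]_x ((2 `^ s)%:E * ((f x `^ (s + 1))%:E * H x)))); last first.
  rewrite ge0_integralZl ?lee_fin ?powR_ge0//.
  - rewrite muleA -EFinM (powRS s0)// le_eqVlt; apply/orP; left; apply/eqP.
    by congr (_%:E * _); ring.
  - by apply: emeasurable_funM => //; exact/measurable_EFinP.
  - by move=> x _; rewrite mule_ge0// lee_fin powR_ge0.
apply: lee_wpmul2l; first by rewrite lee_fin mulr_ge0.
apply: ge0_le_integral => //.
- by move=> x _; apply: sume_ge0 => k _; rewrite mule_ge0 ?lee_fin ?mulr_ge0.
- apply: emeasurable_sum => k; apply: emeasurable_funM => //.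
  by apply/measurable_EFinP; exact: measurable_funM.
- apply: emeasurable_funM => //; apply: emeasurable_funM => //.
  exact/measurable_EFinP.
move=> x _; rewrite -ge0_sume_distrl; last first.
  by move=> k _; rewrite lee_fin mulr_ge0.
rewrite !muleA lee_wpmul2r// sumEFin -!EFinM lee_fin (powRS s0)// mulrCA mulrC.
rewrite ler_wpM2l// -powRM//.
apply: le_trans (telescope_pmax_le x b0 (_ : 0 <= 2 * f x)%R); last exact: mulr_ge0.
apply: ler_sum => k _; rewrite !indicE in_setI /B /=.
rewrite [X in _ && X](_ : _ = (b k <= 2 * f x)%R); last first.
  by apply/idP/idP; rewrite inE.
case: ifPn => [bk|bk]; rewrite ?andbF ?mulr0// andbT.
by case: (boolP (x \in Q k)); rewrite ?mulr0// inE => Qx; rewrite (CP k).2.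
Qed.

End nested.

(** * Shifted triadic intervals on the line *)

Section triadic_grids.
Variable R : realType.
Local Open Scope ring_scope.
Implicit Types (x y l a : R) (b : bool) (k : int).

(** The power 3^k for an integer k of either sign; the exponential form makes comparison with a
    given length a matter of logarithms. *)
Definition side k : R := expR (k%:~R * ln 3).

(* Cells of generation [k] have side [3^k]; translating every generation by half
   a cell ([b = true]) again gives nested partitions, since 3 is odd. *)
Definition gcell b k x : int := Num.floor (x / side k + b%:R / 2).

Lemma side_gt0 k : 0 < side k. Proof. exact: expR_gt0. Qed.

Lemma sideS k : side (k + 1) = 3 * side k.
Proof.
by rewrite /side rmorphD mulrDl expRD mul1r lnK ?posrE// mulrC.
Qed.

(** An integer q satisfies q <= (u + n) / 3 exactly when the integer 3 q - n is at most u, a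
    condition on the floor of u alone. *)
Lemma floor_third (u v : R) (n : int) : Num.floor u = Num.floor v ->
  Num.floor ((u + n%:~R) / 3) = Num.floor ((v + n%:~R) / 3).
Proof.
have aux (u' v' : R) : Num.floor u' = Num.floor v' ->
    Num.floor ((u' + n%:~R) / 3) <= Num.floor ((v' + n%:~R) / 3).
  move=> uv; rewrite floor_ge_int; set q := Num.floor _.
  have : (q%:~R <= (u' + n%:~R) / 3) by exact: floor_le.
  rewrite !ler_pdivlMr// -!lerBlDr.
  have -> : q%:~R * 3 - n%:~R = (q * 3 - n)%:~R :> R by rewrite rmorphB rmorphM.
  by rewrite -!floor_ge_int uv.
by move=> uv; apply/eqP; rewrite eq_le !aux.
Qed.

(** Since 3 (b/2) = b/2 + b, the coarser coordinate is one third of the finer one plus the integer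
    b. This is where the oddness of 3 is used. *)
Lemma gcellS b k x y : gcell b k x = gcell b k y ->
  gcell b (k + 1) x = gcell b (k + 1) y.
Proof.
have aux z : z / side (k + 1) + b%:R / 2 =
    (z / side k + b%:R / 2 + (b : nat)%:Z%:~R) / 3.
  by rewrite sideS; field; rewrite gt_eqF ?side_gt0.
by rewrite /gcell !aux; exact: floor_third.
Qed.

Lemma le_gcell b k j x y : k <= j -> gcell b k x = gcell b k y ->
  gcell b j x = gcell b j y.
Proof.
move=> kj; rewrite -(subrK k j) addrC; move: kj; rewrite -subr_ge0.
case: (j - k) => // n _ xy; elim: n => [|n ih]; first by rewrite addr0.
by rewrite -addn1 PoszD addrA; exact: gcellS.
Qed.

Lemma gcell_itv b k x m :
  gcell b k x = m <->
  side k * (m%:~R - b%:R / 2) <= x < side k * (m%:~R - b%:R / 2) + side k.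
Proof.
have k0 := side_gt0 k.
have -> : gcell b k x = m <-> (Num.floor (x / side k + b%:R / 2) == m).
  by split=> [/eqP|/eqP].
rewrite floor_eq rmorphD/= [X in _ <-> is_true X](_ : _ =
    (m%:~R - b%:R / 2 <= x / side k < m%:~R - b%:R / 2 + 1)); last first.
  by rewrite ler_pdivlMr// ltr_pdivrMr//; congr (_ && _);
    [congr (_ <= _)|congr (_ < _)]; ring.
by split=> /andP[? ?]; apply/andP; split; lra.
Qed.

(* The two grids of generation [k] are at distance [3^k / 2] from each other, so
   an interval shorter than that avoids the endpoints of one of them. *)
Lemma gcell_cover k a l : 0 <= l -> 2 * l < side k ->
  exists b, exists m, forall x, a <= x <= a + l -> gcell b k x = m.
Proof.
move=> l0 lk; have k0 := side_gt0 k.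
have mono b x y : x <= y -> gcell b k x <= gcell b k y.
  by move=> xy; rewrite le_floor// lerD2r ler_pM2r ?invr_gt0.
have [e|ne] := eqVneq (gcell false k a) (gcell false k (a + l)).
  exists false, (gcell false k a) => x /andP[ax xa]; apply/eqP.
  by rewrite eq_le {1}e !mono.
exists true, (gcell false k (a + l)) => x /andP[ax xa]; apply/gcell_itv.
have lt_a : (gcell false k a < gcell false k (a + l)).
  by rewrite lt_neqAle ne mono// lerDl.
set m := gcell false k (a + l) in lt_a *.
have : a < side k * m%:~R.
  move: lt_a; rewrite /gcell floor_lt_int mul0r addr0 ltr_pdivrMr// mulrC//.
have /gcell_itv : gcell false k (a + l) = m by [].
rewrite mul0r subr0 => /andP[m1 m2] m3.
by apply/andP; split; rewrite mulrBr (_ : true%:R = 1)//; lra.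
Qed.

(** k is the last exponent with 3^k <= 6 l; then 3^(k+1) > 6 l. The 6 combines the 2 demanded by
    [gcell_cover] with the ratio 3 of consecutive sides. *)
Lemma side_approx l : 0 < l -> exists k, 2 * l < side k <= 6 * l.
Proof.
move=> l0; have ln3 : 0 < ln (3 : R) by rewrite ln_gt0 ?ltr1n.
pose k := Num.floor (ln (6 * l) / ln 3).
have l6 : 0 < 6 * l by rewrite mulr_gt0.
have e : 6 * l = expR (ln (6 * l)) by rewrite lnK.
exists k; apply/andP; split; last first.
  by rewrite [leRHS]e /side ler_expR -ler_pdivlMr// floor_le.
have : 6 * l < side (k + 1).
  by rewrite [ltLHS]e /side ltr_expR -ltr_pdivrMr// floorD1_gt.
by rewrite sideS => h; lra.
Qed.

End triadic_grids.

(** * Cells, cubes and the maximal function on R^d *)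

Section cells.
Variables (R : realType) (d : nat).
Local Notation V := (Rd R d).
Implicit Types (a x : V) (l : R).

(** Shift in each coordinate, common generation, integer position. The shift vector names one of the
    2^d grids, and the index type is countable, so cells can be enumerated. *)
Definition cellidx := ({ffun 'I_d -> bool} * int * {ffun 'I_d -> int})%type.
Implicit Types c : cellidx.

Definition cell c : set V :=
  [set x | forall i, gcell (c.1.1 i) c.1.2 (tnth x i) = c.2 i].

Definition cside c : R := side R c.1.2.

Definition corner c : V :=
  [tuple (cside c * ((c.2 i)%:~R - (c.1.1 i)%:R / 2))%R | i < d].

Definition hbox a l : set V :=
  [set x | forall i, (tnth a i <= tnth x i < tnth a i + l)%R].

Lemma cside_gt0 c : (0 < cside c)%R. Proof. exact: side_gt0. Qed.

Lemma cellE c : cell c = hbox (corner c) (cside c).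
Proof.
apply/seteqP; split=> x /= cx i; have := cx i; rewrite tnth_mktuple.
  by move/gcell_itv.
by move=> ?; apply/gcell_itv.
Qed.

Lemma hbox_cube a l : hbox a l `<=` cube a l.
Proof. by move=> x ax i; have /andP[-> /ltW ->] := ax i. Qed.

Lemma cell_cube c : cell c `<=` cube (corner c) (cside c).
Proof. by rewrite cellE; exact: hbox_cube. Qed.

Lemma cell_nested c c' : c.1.1 = c'.1.1 -> (c'.1.2 <= c.1.2)%R ->
  cell c' `<=` cell c \/ cell c `&` cell c' = set0.
Proof.
move=> shift lev; have [[y [cy c'y]]|no] := pselect (exists y, (cell c `&` cell c') y).
  left=> x c'x i; rewrite -(cy i); apply: (le_gcell lev).
  by rewrite shift (c'x i) (c'y i).
by right; apply/seteqP; split=> // y cy; apply: no; exists y.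
Qed.

(** The one-dimensional covering is applied in each coordinate at one common generation; the shift
    it selects depends on the coordinate, which is why all 2^d shift vectors are needed. *)
Lemma cube_sub_cell a l : (0 < l)%R ->
  exists c, cube a l `<=` cell c /\ (cside c <= 6 * l)%R.
Proof.
move=> l0; have [k /andP[k1 k2]] := side_approx l0.
have /choice[bm bmP] : forall i : 'I_d, exists bm : bool * int, forall y,
    (tnth a i <= y <= tnth a i + l)%R -> gcell bm.1 k y = bm.2.
  move=> i; have [b [m bmP]] := gcell_cover (tnth a i) (ltW l0) k1.
  by exists (b, m).
exists ([ffun i => (bm i).1], k, [ffun i => (bm i).2]); split=> // x ax i /=.
by rewrite !ffunE; exact/bmP/ax.
Qed.

Lemma measurable_coords (P : 'I_d -> set R) : (forall i, measurable (P i)) ->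
  measurable [set x : V | forall i, P i (tnth x i)].
Proof.
move=> mP; rewrite [X in measurable X](_ : _ =
    \bigcap_(i in [set: 'I_d]) ((fun x : V => tnth x i) @^-1` P i)); last first.
  by apply/seteqP; split=> x /= h i; [move=> _; exact: h|exact: h].
apply: fin_bigcap_measurable => // i _.
by rewrite -[X in measurable X]setTI; exact: measurable_tnth.
Qed.

Lemma measurable_cube a l : measurable (cube a l).
Proof.
apply: (@measurable_coords (fun i => [set` `[tnth a i, (tnth a i + l)%R]])) => i.
exact: measurable_itv.
Qed.

Lemma measurable_hbox a l : measurable (hbox a l).
Proof.
apply: (@measurable_coords (fun i => [set` `[tnth a i, (tnth a i + l)%R[])) => i.
exact: measurable_itv.
Qed.

Lemma measurable_cell c : measurable (cell c).
Proof. by rewrite cellE; exact: measurable_hbox. Qed.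

Variable mu : {measure set V -> \bar R}.
Hypothesis lmu : is_lebesgue mu.

Lemma lebesgue_hbox a l : (0 <= l)%R -> mu (hbox a l) = (l ^+ d)%:E.
Proof.
move=> l0; have := @lmu a [tuple (tnth a i + l)%R | i < d].
rewrite (_ : [set _ | _] = hbox a l); last first.
  apply/seteqP; split=> x /= ax i; have := ax i; rewrite tnth_mktuple//.
move=> ->; last by move=> i; rewrite tnth_mktuple lerDl.
congr (_%:E); rewrite -[X in (_ = _ ^+ X)%R]card_ord -prodr_const.
by apply: eq_bigr => i _; rewrite tnth_mktuple addrC addKr.
Qed.

Lemma lebesgue_cell c : mu (cell c) = (cside c ^+ d)%:E.
Proof. by rewrite cellE lebesgue_hbox// ltW// cside_gt0. Qed.

(** [is_lebesgue] prescribes half-open boxes only; the closed cube lies between those of sides l and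
    l + e, and e tends to 0. *)
Lemma lebesgue_cube a l : (0 <= l)%R -> mu (cube a l) = (l ^+ d)%:E.
Proof.
move=> l0; apply/eqP; rewrite eq_le; apply/andP; split; last first.
  rewrite -(lebesgue_hbox a l0) le_measure ?inE//.
  - exact: measurable_hbox.
  - exact: measurable_cube.
  - exact: hbox_cube.
have ub (e : R) : (0 < e)%R -> mu (cube a l) <= ((l + e) ^+ d)%:E.
  move=> e0; rewrite -(lebesgue_hbox a); last by rewrite addr_ge0// ltW.
  rewrite le_measure ?inE//.
  - exact: measurable_cube.
  - exact: measurable_hbox.
  by move=> x ax i; have /andP[-> h /=] := ax i; rewrite (le_lt_trans h)// ltrD2l ltrDl.
have : ((l + n.+1%:R^-1) ^+ d)%R @[n --> \oo] --> (l ^+ d)%R.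
  have : (l + n.+1%:R^-1)%R @[n --> \oo] --> (l + 0)%R.
    by apply: cvgD; [exact: cvg_cst|exact: cvg_harmonic].
  by rewrite addr0 => h; exact: cvg_comp h (@exprn_continuous R d l).
move=> h; have {}h : (((l + n.+1%:R^-1) ^+ d)%R)%:E @[n --> \oo] --> (l ^+ d)%:E.
  by apply: cvg_EFin h; exact: nearW.
rewrite -(cvg_lim _ h)//; apply: lime_ge; first by apply/cvg_ex; eexists; exact: h.
by apply: nearW => n; exact: ub.
Qed.

Lemma lt_avg_cube (t : R) a l (f : V -> R) : (0 < l)%R ->
  (t%:E < avg mu (cube a l) f) =
  ((t * l ^+ d)%:E < \int[mu]_(y in cube a l) (`|f y|)%:E).
Proof.
move=> l0; rewrite /avg lebesgue_cube ?(ltW l0)//= lte_pdivlMl ?exprn_gt0//.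
by rewrite mulrC EFinM.
Qed.

Lemma maximal_ge f a l x : (0 < l)%R -> cube a l x ->
  avg mu (cube a l) f <= maximal_cube mu f x.
Proof. by move=> l0 ax; apply: ereal_sup_ubound; exists (a, l). Qed.

Lemma maximal_ge0 f x : 0 <= maximal_cube mu f x.
Proof.
apply: (le_trans _ (@maximal_ge f x 1 x _ _)) => //; last first.
  by move=> i; rewrite lexx lerDl ler01.
rewrite /avg mule_ge0 ?lee_fin ?invr_ge0 ?fine_ge0//.
by rewrite integral_ge0// => y _; rewrite lee_fin.
Qed.

Lemma maximal_gtP (t : R) f x : t%:E < maximal_cube mu f x ->
  exists a l, [/\ (0 < l)%R, cube a l x & t%:E < avg mu (cube a l) f].
Proof. by move=> /ereal_sup_gt[_ [[a l] /= [l0 ax] <-] ?]; exists a, l. Qed.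

(** A cube whose average exceeds t can be enlarged to one with rational corner and side whose
    average still exceeds t, so the set where M f > t is a countable union of cubes. *)
Lemma measurable_maximal f : measurable_fun setT f ->
  measurable_fun setT (maximal_cube mu f).
Proof.
move=> mf mT; apply: (measurability _ (ErealGenOInfty.measurableE R)) => //.
move=> _ [_ [t ->] <-]; rewrite setTI.
pose qcube (q : d.-tuple rat * rat) : set V := cube [tuple ratr (tnth q.1 i) | i < d] (ratr q.2).
pose good (q : d.-tuple rat * rat) := (0 < (ratr q.2 : R))%R /\ t%:E < avg mu (qcube q) f.
rewrite [X in measurable X](_ : _ =
    \bigcup_q (if pselect (good q) then qcube q else set0)); last first.
  apply/seteqP; split=> x /=; rewrite in_itv/= andbT; last first.
    move=> [q _]; case: pselect => // -[q0 qt] qx.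
    by rewrite (lt_le_trans qt)// maximal_ge.
  move=> /maximal_gtP[a [l [l0 ax]]]; rewrite lt_avg_cube//.
  set I := integral _ _ _ => tI.
  (* Enlarging the cube cannot decrease the integral of |f|, and t l'^d stays below [I] for l' close
     to l; if [I] is infinite any l' will do. *)
  have [e e0 He] : exists2 e : R, (0 < e)%R & forall l', (l < l' < l + e)%R ->
      (t * l' ^+ d)%:E < I.
    have ct : {for l, continuous (fun y : R => t * y ^+ d)%R}.
      by move=> /=; apply: cvgM; [exact: cvg_cst|exact: exprn_continuous].
    move: tI; case: I => [r||//] tI; last first.
      by exists 1%R => // l' _; rewrite ltry.
    move: tI; rewrite lte_fin => /(cvgr_lt _ ct).
    move=> /nbhs_ballP[e /= e0 He]; exists e => // l' /andP[ll' l'e].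
    by apply: He; rewrite /ball/= ltr_distlC; apply/andP; split; lra.
  have [ql] := @rat_in_itvoo R l (l + e)%R ltac:(by rewrite ltrDl).
  rewrite in_itv/= => /andP[lql qle].
  (* The corner moves left by less than [ratr ql - l], so the enlarged cube still reaches the right
     end a + l. *)
  have /choice[qa qaP] : forall i : 'I_d, exists q : rat,
      (tnth a i + l - ratr ql < ratr q < tnth a i)%R.
    move=> i; have [|q] := @rat_in_itvoo R (tnth a i + l - ratr ql)%R (tnth a i).
      by lra.
    by rewrite in_itv; exists q.
  pose q := ([tuple qa i | i < d], ql).
  have sub : cube a l `<=` qcube q.
    move=> y ay i; rewrite !tnth_mktuple; have /andP[] := ay i; have /andP[] := qaP i.
    by move=> *; apply/andP; split; rewrite /=; lra.
  exists q => //; case: pselect => [gq|ngq]; first exact: sub.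
  exfalso; apply: ngq; split; first by rewrite (lt_trans l0).
  rewrite lt_avg_cube/= ?(lt_trans l0)//.
  apply: (lt_le_trans (He _ _)); first by rewrite lql qle.
  apply: ge0_subset_integral => //.
  - exact: measurable_cube.
  - exact: measurable_cube.
  - apply/measurable_EFinP/measurable_funTS; exact: measurableT_comp.
apply: countable_bigcupT_measurable; first exact: countableP.
by move=> q; case: pselect => [gq|ngq]; [exact: measurable_cube|exact: measurable0].
Qed.

End cells.
Arguments cell R {d} c.
Arguments cside R {d} c.

(** * Exhaustion of R^d by cubes centred at the origin *)

Section exhaustion.
Variables (R : realType) (d : nat).
Local Notation V := (Rd R d).

Definition big_cube (n : nat) : set V :=
  cube [tuple (- n.+1%:R)%R | i < d] (2 * n.+1%:R)%R.

Lemma cube_sub_big_cube (a : V) (l : R) : (0 <= l)%R ->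
  exists n, cube a l `<=` big_cube n.
Proof.
move=> l0; pose S := (\sum_(i < d) `|tnth a i| + l)%R.
have S0 : (0 <= S)%R by rewrite addr_ge0// sumr_ge0.
exists (Num.truncn S) => x ax i; rewrite !tnth_mktuple.
have /andP[ax1 ax2] := ax i.
have nS : (S < (Num.truncn S).+1%:R)%R by exact: truncnS_gt.
have aS : (`|tnth a i| + l <= S)%R.
  by rewrite lerD2r (bigD1 i)//= lerDl sumr_ge0.
have : (`|tnth a i| <= S - l)%R by lra.
rewrite ler_norml => /andP[? ?]; apply/andP; split; lra.
Qed.

Lemma big_cube_cover (x : V) : exists n, big_cube n x.
Proof.
have [n xn] := @cube_sub_big_cube x 0%R (lexx _).
by exists n; apply: xn => i; rewrite addr0 lexx.
Qed.

Lemma subset_big_cube m n : (m <= n)%N -> big_cube m `<=` big_cube n.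
Proof.
move=> mn x xm i; have := xm i; rewrite !tnth_mktuple => /andP[? ?].
have : (m.+1%:R <= n.+1%:R :> R)%R by rewrite ler_nat.
by move=> ?; apply/andP; split; lra.
Qed.

Lemma measurable_big_cube n : measurable (big_cube n).
Proof. exact: measurable_cube. Qed.

Lemma big_cube_meets (mu : {measure set V -> \bar R}) (F : set V) :
  measurable F -> 0 < mu F -> exists n, 0 < mu (big_cube n `&` F).
Proof.
move=> mF F0; apply: contrapT => /forallNP no.
suff : mu F = 0 by move=> e; rewrite e ltxx in F0.
apply: measure_negligible => //.
apply: (@negligibleS _ _ _ _ (\bigcup_n (big_cube n `&` F))).
  by move=> x Fx; have [n xn] := big_cube_cover x; exists n.
apply: negligible_bigcup => n; apply/negligibleP.
  by apply: measurableI => //; exact: measurable_big_cube.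
by apply/eqP; rewrite eq_le measure_ge0 andbT leNgt; apply/negP/no.
Qed.

End exhaustion.
Arguments big_cube : clear implicits.

(** * Koethe duality *)

Section kothe_theory.
Variables (R : realType) (d : nat).
Local Notation V := (Rd R d).
Variable mu : {measure set V -> \bar R}.
Hypothesis lmu : is_lebesgue mu.
Variable N : fnorm R d.
Implicit Types f g h : V -> R.

(** The Koethe dual is taken both of X and of (X')^theta. The duality theory is built on these three
    properties, which are verified for each. *)
Definition homogeneous := forall f (c : R), (0 < c)%R -> inspace N f ->
  N (fun x => c * f x)%R = c%:E * N f.
Definition definite := forall f, measurable_fun setT f -> N f = 0 ->
  {ae mu, forall x, f x = 0%R}.
Definition cube_regular := forall (a : V) (l : R), (0 < l)%R ->
  0 < N (\1_(cube a l)) < +oo.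

Hypothesis Nhom : homogeneous.
Hypothesis Ncube : cube_regular.

Lemma inspace_cube (a : V) (l : R) : (0 < l)%R -> inspace N (\1_(cube a l)).
Proof.
move=> l0; split; last by have /andP[] := Ncube a l0.
by apply: measurable_indic; exact: measurable_cube.
Qed.

Lemma inspace_normalize f : inspace N f -> 0 < N f ->
  inspace N (fun x => (fine (N f))^-1 * f x)%R /\
  N (fun x => (fine (N f))^-1 * f x)%R = 1.
Proof.
move=> [mf Nf] N0; have Nfin : N f \is a fin_num by rewrite gt0_fin_numE.
have f0 : (0 < fine (N f))%R by rewrite fine_gt0// N0.
have e : N (fun x => (fine (N f))^-1 * f x)%R = 1.
  rewrite Nhom ?invr_gt0//.
  by rewrite -{2}(fineK Nfin) -EFinM mulVf// gt_eqF.
by split=> //; split; [exact: measurable_funM|rewrite e ltry].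
Qed.

Lemma kothe_ub f g : inspace N f -> N f = 1 ->
  \int[mu]_x (`|f x * g x|)%:E <= kothe mu N g.
Proof. by move=> Nf f1; apply: ereal_sup_ubound; exists f. Qed.

Lemma kothe_le g B :
  (forall f, inspace N f -> N f = 1 -> \int[mu]_x (`|f x * g x|)%:E <= B) ->
  kothe mu N g <= B.
Proof. by move=> gB; apply: ge_ereal_sup => _ [f [Nf f1] <-]; exact: gB. Qed.

Lemma measurable_abs_mul f g : measurable_fun setT f -> measurable_fun setT g ->
  measurable_fun setT (fun x => (`|f x * g x|)%:E).
Proof.
move=> mf mg; apply/measurable_EFinP; apply: measurableT_comp => //.
exact: measurable_funM.
Qed.

Lemma integral_abs_ge0 f : 0 <= \int[mu]_x (`|f x|)%:E.
Proof. by apply: integral_ge0 => x _; rewrite lee_fin. Qed.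

(** A supremum over an empty unit sphere would be -oo; a normalized indicator of a cube shows that
    the sphere is inhabited. *)
Lemma kothe_ge0 g : 0 <= kothe mu N g.
Proof.
have l0 : (0 < 1 :> R)%R by [].
pose a : V := [tuple 0%R | i < d].
have /andP[N0 _] := Ncube a l0.
have [Nf f1] := inspace_normalize (inspace_cube a l0) N0.
by apply: le_trans (kothe_ub g Nf f1); apply: integral_abs_ge0.
Qed.

Lemma integralZ_abs f g (c : R) : (0 <= c)%R -> measurable_fun setT f ->
  measurable_fun setT g ->
  \int[mu]_x (`|f x * (c * g x)|)%:E = c%:E * \int[mu]_x (`|f x * g x|)%:E.
Proof.
move=> c0 mf mg; rewrite -ge0_integralZl ?lee_fin//; last first.
  exact: measurable_abs_mul.
by apply: eq_integral => x _; rewrite mulrCA normrM (ger0_norm c0).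
Qed.

Lemma kotheZ g (c : R) : (0 < c)%R -> measurable_fun setT g ->
  kothe mu N (fun x => c * g x)%R = c%:E * kothe mu N g.
Proof.
have le_ (c' : R) g' : (0 < c')%R -> measurable_fun setT g' ->
    kothe mu N (fun x => c' * g' x)%R <= c'%:E * kothe mu N g'.
  move=> c0 mg; apply: kothe_le => f Nf f1.
  rewrite integralZ_abs ?(ltW c0)//; last by case: Nf.
  by rewrite lee_pmul2l ?lte_fin//; exact: kothe_ub.
move=> c0 mg; apply/eqP; rewrite eq_le le_//=.
rewrite -lee_pdivlMl//.
have -> : kothe mu N g = kothe mu N (fun x => c^-1 * (c * g x))%R.
  by congr (kothe mu N _); apply/funext => x; rewrite mulKf// gt_eqF.
by apply: le_; [rewrite invr_gt0|exact: measurable_funM].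
Qed.

Lemma kothe_mono f g : measurable_fun setT f -> measurable_fun setT g ->
  (forall x, `|f x| <= `|g x|)%R -> kothe mu N f <= kothe mu N g.
Proof.
move=> mf mg fg; apply: kothe_le => h Nh h1; apply: le_trans (kothe_ub g Nh h1).
have mh : measurable_fun setT h by case: Nh.
apply: ge0_le_integral => //; [exact: measurable_abs_mul|exact: measurable_abs_mul|].
by move=> x _; rewrite lee_fin !normrM ler_wpM2l.
Qed.

Lemma kotheD f g : measurable_fun setT f -> measurable_fun setT g ->
  kothe mu N (fun x => f x + g x)%R <= kothe mu N f + kothe mu N g.
Proof.
move=> mf mg; apply: kothe_le => h Nh h1.
have mh : measurable_fun setT h by case: Nh.
apply: le_trans (leeD (kothe_ub f Nh h1) (kothe_ub g Nh h1)).
rewrite -ge0_integralD//; try exact: measurable_abs_mul.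
apply: ge0_le_integral => //.
- by apply: measurable_abs_mul => //; exact: measurable_funD.
- by apply: emeasurable_funD; exact: measurable_abs_mul.
- by move=> x _; rewrite -EFinD lee_fin mulrDr ler_normD.
Qed.

Lemma kothe_sum (I : Type) (s : seq I) (F : I -> V -> R) :
  (forall i, measurable_fun setT (F i)) ->
  kothe mu N (fun x => \sum_(i <- s) F i x)%R <= \sum_(i <- s) kothe mu N (F i).
Proof.
move=> mF; elim: s => [|i s ih].
  rewrite big_nil; apply: kothe_le => f _ _.
  rewrite (eq_integral (cst 0)) ?integral0// => x _.
  by rewrite big_nil mulr0 normr0.
rewrite big_cons; apply: le_trans (leeD (lexx _) ih).
under eq_fun do rewrite big_cons.
by apply: kotheD => //; exact: measurable_sum.
Qed.

(** Testing against the normalized indicators of the cubes [big_cube n] shows that |g| has zero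
    integral over each of them. *)
Lemma kothe_definite g : measurable_fun setT g -> kothe mu N g = 0 ->
  {ae mu, forall x, g x = 0%R}.
Proof.
move=> mg g0.
have ae_n n : {ae mu, forall x, big_cube R d n x -> g x = 0%R}.
  have l0 : (0 < 2 * n.+1%:R :> R)%R by rewrite mulr_gt0.
  set a : V := [tuple (- n.+1%:R)%R | i < d].
  have /andP[N0 Nfin] := Ncube a l0.
  have [Nf f1] := inspace_normalize (inspace_cube a l0) N0.
  set r := ((fine (N _))^-1)%R in Nf f1.
  have r0 : (0 < r)%R by rewrite invr_gt0 fine_gt0// N0.
  have mB := @measurable_big_cube R d n.
  have : \int[mu]_(x in big_cube R d n) `|(g x)%:E| = 0.
    apply/eqP; rewrite eq_le integral_ge0 ?andbT; last by move=> x _; exact: abse_ge0.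
    have := kothe_ub g Nf f1; rewrite g0.
    rewrite (_ : \int[mu]_x _ = r%:E * \int[mu]_(x in big_cube R d n) `|(g x)%:E|).
      by rewrite pmule_rle0 ?lte_fin.
    rewrite -(ge0_integral_mulindic mu _ mB).
    have m1 : measurable_fun setT
        (fun x => (\1_(big_cube R d n) x : R)%:E * `|(g x)%:E|).
      apply: emeasurable_funM.
        by apply/measurable_EFinP; exact: measurable_indic.
      by apply: measurableT_comp => //; exact/measurable_EFinP.
    rewrite -(ge0_integralZl mu measurableT m1) ?lee_fin ?(ltW r0)//.
    apply: eq_integral => x _; rewrite -!EFinM; congr (_%:E).
    by rewrite !normrM (gtr0_norm r0) (ger0_norm (_ : 0 <= \1_(_) x)%R) ?mulrA.
  move/(ae_eq_integral_abs mu mB) => /(_ _)/wrap[].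
    exact/measurable_EFinP/measurable_funTS.
  by apply: filterS => x /= xg xB; have [] := xg xB.
have := ae_foralln ae_n; apply: filterS => x gx.
by have [n] := big_cube_cover x; exact: gx.
Qed.

Hypothesis Ndef : definite.

Lemma kothe_hoelder f g : (0 <= N f) -> inspace N f -> measurable_fun setT g ->
  \int[mu]_x (`|f x * g x|)%:E <= N f * kothe mu N g.
Proof.
move=> Nf0 Nf mg; have mf : measurable_fun setT f by case: Nf.
(* A function of norm zero cannot be normalized; definiteness makes it vanish almost everywhere, and
   0 times +oo is 0 if the dual norm of g is infinite. *)
move: Nf0; rewrite le_eqVlt => /predU1P[N0|N0].
  rewrite -N0 mul0e (ae_eq_integral (cst 0)) ?integral0//; last first.
    apply: filterS (Ndef mf (esym N0)) => x fx _ /=.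
    by rewrite fx mul0r normr0.
  exact: measurable_abs_mul.
have [Nf' f1] := inspace_normalize Nf N0.
have Nfin : N f \is a fin_num by rewrite gt0_fin_numE//; case: Nf.
have f0 : (0 < fine (N f))%R by rewrite fine_gt0// N0; case: Nf.
rewrite -(fineK Nfin) -lee_pdivrMl//; apply: le_trans (kothe_ub g Nf' f1).
rewrite -integralZ_abs ?invr_ge0 ?(ltW f0)//.
by under eq_integral do rewrite mulrCA mulrA.
Qed.

End kothe_theory.

(** * Powers of a function norm *)

Section fpower_theory.
Variables (R : realType) (d : nat).
Local Notation V := (Rd R d).
Variable mu : {measure set V -> \bar R}.
Variables (K : fnorm R d) (theta : R).
Hypothesis K0 : forall f, 0 <= K f.
Hypothesis t0 : (0 < theta)%R.
Implicit Types f g : V -> R.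

Local Notation Y := (fpower K theta).
Local Notation pw f := (fun x => `|f x| `^ theta^-1)%R.

Lemma measurable_abs_powR f (p : R) : measurable_fun setT f ->
  measurable_fun setT (fun x => `|f x| `^ p)%R.
Proof.
by move=> mf; apply: (measurableT_comp (measurable_powR p)); exact: measurableT_comp.
Qed.

Lemma fpower_lty f : Y f < +oo -> K (pw f) < +oo.
Proof.
rewrite /fpower ltey => /eqP Yf; rewrite ltey; apply/eqP => e.
by apply: Yf; rewrite e poweRyr// gt_eqF.
Qed.

(** Monotonicity of t^theta. Through this lemma every bound for r-th powers in X' becomes a bound in
    (X')^theta. *)
Lemma fpower_le (C : R) f g : (0 <= C)%R ->
  K (pw f) <= (C `^ theta^-1)%:E * K (pw g) -> Y f <= C%:E * Y g.
Proof.
move=> C0 h; have e : C%:E = poweR ((C `^ theta^-1)%:E) theta.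
  by rewrite poweR_EFin -powRrM mulVf ?gt_eqF// powRr1.
rewrite {1}e -poweRM ?lee_fin ?powR_ge0//.
have C1 : 0 <= (C `^ theta^-1)%:E * K (pw g).
  by rewrite mule_ge0// lee_fin powR_ge0.
by apply: gt0_ler_poweR => //; rewrite ?(ltW t0)// in_itv/= leey andbT.
Qed.

Hypothesis Kdef : definite mu K.
Hypothesis Kcube : cube_regular K.

Lemma fpower_definite : definite mu Y.
Proof.
move=> f mf /poweR_eq0_eq0 Yf; have {}Yf := Yf (K0 _).
apply: filterS (Kdef (measurable_abs_powR _ mf) Yf) => x /powR_eq0_eq0.
by move/normr0_eq0.
Qed.

Lemma fpower_indic (A : set V) : Y (\1_A) = poweR (K (\1_A)) theta.
Proof.
rewrite /fpower; congr (poweR (K _) _); apply/funext => x; rewrite indicE.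
case: (x \in A); first by rewrite normr1 powR1.
by rewrite normr0 powR0// invr_eq0 gt_eqF.
Qed.

Lemma fpower_cube_regular : cube_regular Y.
Proof.
move=> a l l0; have /andP[K1 K2] := Kcube a l0.
by rewrite fpower_indic poweR_gt0//= poweR_lty.
Qed.

End fpower_theory.

(** * Consequences of the boundedness of M on X *)

Section qbfs.
Variables (R : realType) (d : nat).
Local Notation V := (Rd R d).
Variable mu : {measure set V -> \bar R}.
Hypothesis lmu : is_lebesgue mu.
Variable X : fnorm R d.
Hypothesis qX : is_qBfs mu X.
Variable m : R.
Hypothesis bX : bounded_with mu X (maximal_cube mu) m.
Implicit Types f g h : V -> R.

Lemma lebesgue_cube_gt0 (a : V) (l : R) : (0 < l)%R -> 0 < mu (cube a l).
Proof. by move=> l0; rewrite (lebesgue_cube lmu) ?(ltW l0)// lte_fin exprn_gt0. Qed.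

Lemma indic_not_ae0 (A : set V) : measurable A -> 0 < mu A ->
  ~ {ae mu, forall x, \1_A x = 0%R :> R}.
Proof.
move=> mA A0 ae0; suff : mu A = 0 by move=> e; rewrite e ltxx in A0.
apply: measure_negligible => //; apply: negligibleS ae0 => x Ax /=.
by rewrite indicE mem_set//; apply/eqP; rewrite oner_eq0.
Qed.

Lemma qbfs_ge0 f : 0 <= X f. Proof. by case: qX. Qed.

Lemma qbfs_homogeneous : homogeneous X.
Proof. by case: qX => _ [_ [hom _]] f c c0 Xf; rewrite hom// gtr0_norm. Qed.

Lemma qbfs_definite : definite mu X.
Proof.
case: qX => _ [def _] f mf f0; apply/def => //; split=> //.
by rewrite f0 ltry.
Qed.

Lemma qbfs_ideal f g : inspace X f -> measurable_fun setT g ->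
  {ae mu, forall x, (`|g x| <= `|f x|)%R} -> inspace X g /\ X g <= X f.
Proof. by case: qX => _ [_ [_ [_ [_ [ideal _]]]]]; exact: ideal. Qed.

Lemma qbfs_maximal f : inspace X f -> inspace X (fun x => fine (maximal_cube mu f x)) /\
  X (fun x => fine (maximal_cube mu f x)) <= m%:E * X f.
Proof.
move=> Xf; have [mM _ XM] := bX Xf; split=> //; split; first exact: measurableT_comp.
apply: (le_lt_trans XM); have : X f \is a fin_num.
  by rewrite ge0_fin_numE ?qbfs_ge0//; case: Xf.
by move=> /fineK <-; rewrite -EFinM ltry.
Qed.

(* Some [1_F] lies in [X]; its maximal function is bounded below on every cube. *)
Lemma qbfs_cube_regular : cube_regular X.
Proof.
move=> a l l0; set K := cube a l.
have mK : measurable K by exact: measurable_cube.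
have XK : inspace X (\1_K).
  case: qX => _ [_ [_ [_ [_ [_ sat]]]]].
  have T0 : 0 < mu setT.
    apply: (lt_le_trans (lebesgue_cube_gt0 a l0)).
    by apply: le_measure; rewrite ?inE.
  have [F [mF _ F0 XF]] := sat _ measurableT T0.
  have [n1 Fn1] := big_cube_meets mF F0.
  have [n2 Kn2] := cube_sub_big_cube a (ltW l0).
  (* Large enough for the centred cube to contain K and to meet F in positive measure. The average
     [del] of 1_F over it bounds M 1_F from below on K. *)
  pose n := maxn n1 n2.
  have mB := @measurable_big_cube R d n.
  have mBF : measurable (big_cube R d n `&` F) by exact: measurableI.
  have n0 : (0 < 2 * n.+1%:R :> R)%R by rewrite mulr_gt0.
  have muB : mu (big_cube R d n) = ((2 * n.+1%:R) ^+ d)%:E.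
    by rewrite (lebesgue_cube lmu) ?(ltW n0).
  have Fn : 0 < mu (big_cube R d n `&` F).
    apply: (lt_le_trans Fn1); apply: le_measure; rewrite ?inE//.
      by apply: measurableI => //; exact: measurable_big_cube.
    by apply: setSI; apply: subset_big_cube; exact: leq_maxl.
  have Ffin : mu (big_cube R d n `&` F) \is a fin_num.
    rewrite gt0_fin_numE//.
    apply: (@le_lt_trans _ _ (mu (big_cube R d n))); last by rewrite muB ltry.
    by apply: le_measure; rewrite ?inE//; exact: subIsetl.
  pose del : R := (((2 * n.+1%:R) ^+ d)^-1 * fine (mu (big_cube R d n `&` F)))%R.
  have del0 : (0 < del)%R.
    by rewrite mulr_gt0 ?invr_gt0 ?exprn_gt0// fine_gt0// Fn -ge0_fin_numE.
  have avgF : avg mu (big_cube R d n) (\1_F) = del%:E.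
    rewrite /avg muB /= EFinM fineK//; congr (_ * _).
    under eq_integral do rewrite ger0_norm//.
    by rewrite integral_indic// setIC.
  have [XM _] := qbfs_maximal XF.
  have Mdel x : K x -> del%:E <= maximal_cube mu (\1_F) x.
    move=> Kx; rewrite -avgF; apply: (maximal_ge mu _ n0).
    by apply: (subset_big_cube (leq_maxr n1 n2)); exact: Kn2.
  have Xg : inspace X (fun x => del^-1 * fine (maximal_cube mu (\1_F) x))%R.
    split; first by apply: measurable_funM => //; case: XM.
    rewrite qbfs_homogeneous ?invr_gt0//.
    have /fineK <- : X (fun x => fine (maximal_cube mu (\1_F) x)) \is a fin_num.
      by rewrite ge0_fin_numE ?qbfs_ge0//; case: XM.
    by rewrite -EFinM ltry.
  apply: (qbfs_ideal Xg _ _).1; first exact: measurable_indic.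
  have [_ Mfin _] := bX XF; apply: filterS Mfin => x Mx.
  rewrite indicE; case: (boolP (x \in K)) => [|_]; last by rewrite normr0.
  rewrite inE => Kx; rewrite normr1 normrM (gtr0_norm (_ : 0 < del^-1)%R) ?invr_gt0//.
  rewrite ler_pdivlMl// mulr1 (le_trans _ (ler_norm _))//.
  by rewrite -lee_fin fineK//; exact: Mdel.
apply/andP; split; last by case: XK.
rewrite lt_neqAle qbfs_ge0 andbT; apply/negP => /eqP/esym X0.
have mI : measurable_fun setT (\1_K : V -> R) by exact: measurable_indic.
have := qbfs_definite mI X0.
by apply: indic_not_ae0 => //; exact: lebesgue_cube_gt0.
Qed.

(** For a cube K one has M 1_K >= 1 on K, hence |1_K| <= m |1_K| with a positive finite norm. In
    particular m > 0, as the absorption requires. *)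
Lemma opnorm_ge1 : (1 <= m)%R.
Proof.
pose a : V := [tuple 0%R | i < d]; have l0 : (0 < 1 :> R)%R by [].
set K := cube a 1.
have mK : measurable K by exact: measurable_cube.
have /andP[X0 Xf] := qbfs_cube_regular a l0.
have XK := inspace_cube qbfs_cube_regular a l0.
have [XM XMle] := qbfs_maximal XK.
have Xfin : X (\1_K) \is a fin_num by rewrite gt0_fin_numE.
have avgK : avg mu K (\1_K) = 1.
  rewrite /avg (lebesgue_cube lmu)//= expr1n invr1 mul1e.
  under eq_integral do rewrite ger0_norm//.
  by rewrite integral_indic// setIid (lebesgue_cube lmu)// expr1n.
have : X (\1_K) <= m%:E * X (\1_K).
  apply: le_trans XMle; apply: (qbfs_ideal XM _ _).2; first exact: measurable_indic.
  have [_ Mfin _] := bX XK; apply: filterS Mfin => x Mx.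
  rewrite {1}indicE; case: (boolP (x \in K)) => [|_]; last by rewrite normr0.
  rewrite inE => Kx; rewrite normr1 (le_trans _ (ler_norm _))//.
  by rewrite -lee_fin fineK// -avgK; exact: maximal_ge.
rewrite -(fineK Xfin) -EFinM lee_fin -ler_pdivrMr ?divff ?gt_eqF//;
  by rewrite fine_gt0// X0.
Qed.

(** Finiteness: if A is the average over K of |f|, with f of norm 1, then A 1_K <= M f, so A |1_K|
    <= m; this bounds the integral of |f| over K uniformly in f. *)
Lemma kothe_cube_regular : cube_regular (kothe mu X).
Proof.
move=> a l l0; set K := cube a l.
have mK : measurable K by exact: measurable_cube.
apply/andP; split.
  rewrite lt_neqAle (kothe_ge0 mu qbfs_homogeneous qbfs_cube_regular) andbT.
  apply/negP => /eqP/esym K0.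
  have mI : measurable_fun setT (\1_K : V -> R) by exact: measurable_indic.
  have := kothe_definite qbfs_homogeneous qbfs_cube_regular mI K0.
  by apply: indic_not_ae0 => //; exact: lebesgue_cube_gt0.
have /andP[X0 Xf] := qbfs_cube_regular a l0.
have XK := inspace_cube qbfs_cube_regular a l0.
have Xfin : X (\1_K) \is a fin_num by rewrite gt0_fin_numE.
have XK0 : (0 < fine (X (\1_K)))%R by rewrite fine_gt0// X0.
have ld : (0 < l ^+ d)%R by rewrite exprn_gt0.
apply: (@le_lt_trans _ _ (l ^+ d * (m / fine (X (\1_K))))%:E); last exact: ltry.
apply: kothe_le => f Xf' f1; have [mM Mfin _] := bX Xf'.
have mf : measurable_fun setT f by case: Xf'.
have [XM XMle] := qbfs_maximal Xf'; rewrite f1 mule1 in XMle.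
have -> : \int[mu]_x (`|f x * \1_K x|)%:E = \int[mu]_(x in K) (`|f x|)%:E.
  rewrite -(ge0_integral_mulindic mu _ mK); apply: eq_integral => x _.
  by rewrite normrM mulrC EFinM (ger0_norm (_ : 0 <= \1_K x)%R).
rewrite EFinM -lee_pdivrMl//.
have -> : (l ^+ d)^-1%:E * \int[mu]_(x in K) (`|f x|)%:E = avg mu K f.
  by rewrite /avg (lebesgue_cube lmu) ?(ltW l0).
have avg0 : 0 <= avg mu K f.
  rewrite /avg mule_ge0 ?lee_fin ?invr_ge0 ?fine_ge0//.
  by rewrite integral_ge0// => x _; rewrite lee_fin.
have avgM x : K x -> avg mu K f <= maximal_cube mu f x by exact: maximal_ge.
(* An infinite average would make M f infinite on all of K, a set of positive measure. *)
have afin : avg mu K f \is a fin_num.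
  apply: contrapT => ninf; apply: (@indic_not_ae0 K) => //.
    exact: lebesgue_cube_gt0.
  apply: filterS Mfin => x Mx; rewrite indicE.
  case: (boolP (x \in K)) => //; rewrite inE => /avgM aM; exfalso; apply: ninf.
  rewrite ge0_fin_numE//; apply: (le_lt_trans aM).
  by rewrite ltey_eq Mx.
rewrite -(fineK afin) lee_fin ler_pdivlMr//.
have := avg0; rewrite -{1}(fineK afin) lee_fin le_eqVlt => /predU1P[<-|A0].
  by rewrite mul0r (le_trans _ opnorm_ge1).
rewrite -lee_fin EFinM (fineK Xfin) -qbfs_homogeneous//.
apply: le_trans XMle; apply: (qbfs_ideal XM _ _).2.
  by apply: measurable_funM => //; exact: measurable_indic.
apply: filterS Mfin => x Mx; rewrite indicE.
case: (boolP (x \in K)) => [|_]; last by rewrite mulr0 normr0.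
rewrite inE => Kx; rewrite mulr1 ger0_norm ?(ltW A0)// (le_trans _ (ler_norm _))//.
by rewrite -lee_fin !fineK//; exact: avgM.
Qed.

(** Hoelder's inequality for G and M h, the latter of norm at most m in X. This is how m enters the
    weighted estimates. *)
Lemma integral_mul_maximal_le (G h : V -> R) : measurable_fun setT G ->
  (forall x, 0 <= G x)%R -> inspace X h -> X h = 1 ->
  \int[mu]_x ((G x)%:E * maximal_cube mu h x) <= m%:E * kothe mu X G.
Proof.
move=> mG G0 Xh h1; have [mM Mfin _] := bX Xh.
have [XM XMle] := qbfs_maximal Xh; rewrite h1 mule1 in XMle.
rewrite (ge0_ae_eq_integral (g := fun x =>
    (`|fine (maximal_cube mu h x) * G x|)%:E))//; last 4 first.
- by apply: emeasurable_funM => //; exact/measurable_EFinP.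
- by apply: measurable_abs_mul => //; case: XM.
- by move=> x _; rewrite mule_ge0 ?lee_fin// maximal_ge0.
- apply: filterS Mfin => x Mx _.
  rewrite normrM (ger0_norm (G0 x)) ger0_norm ?fine_ge0 ?maximal_ge0//.
  by rewrite EFinM fineK// muleC.
apply: (le_trans (kothe_hoelder qbfs_homogeneous qbfs_definite (qbfs_ge0 _) XM mG)).
apply: lee_wpmul2r => //.
exact: (kothe_ge0 mu qbfs_homogeneous qbfs_cube_regular).
Qed.

End qbfs.

(** * Averages over cells *)

Section cell_averages.
Variables (R : realType) (d : nat).
Local Notation V := (Rd R d).
Variable mu : {measure set V -> \bar R}.
Hypothesis lmu : is_lebesgue mu.
Implicit Types (f h : V -> R) (c : cellidx d).

Definition cvol c : R := (cside R c ^+ d)%R.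

Lemma cvol_gt0 c : (0 < cvol c)%R.
Proof. by rewrite exprn_gt0// cside_gt0. Qed.

(** Real valued, so that real maxima and powers apply; [fine] would read an infinite integral as 0,
    which [cell_integrable] rules out. *)
Definition cavg f c : R :=
  ((cvol c)^-1 * fine (\int[mu]_(y in cell R c) (`|f y|)%:E))%R.

Lemma cavg_ge0 f c : (0 <= cavg f c)%R.
Proof.
rewrite mulr_ge0 ?invr_ge0 ?(ltW (cvol_gt0 c))// fine_ge0//.
by apply: integral_ge0 => x _; rewrite lee_fin.
Qed.

Definition cell_integrable f :=
  forall c, \int[mu]_(y in cell R c) (`|f y|)%:E < +oo.

Lemma integral_cell f c : cell_integrable f ->
  \int[mu]_(y in cell R c) (`|f y|)%:E = (cvol c * cavg f c)%:E.
Proof.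
move=> fc; rewrite mulrA divff ?gt_eqF ?cvol_gt0// mul1r fineK//.
rewrite ge0_fin_numE//; apply: integral_ge0 => x _; by rewrite lee_fin.
Qed.

Lemma cell_average_le_maximal h c x : measurable_fun setT h -> cell R c x ->
  ((cvol c)^-1)%:E * \int[mu]_(y in cell R c) (`|h y|)%:E <= maximal_cube mu h x.
Proof.
move=> mh cx; apply: le_trans (maximal_ge mu h (cside_gt0 R c) (cell_cube cx)).
rewrite /avg (lebesgue_cube lmu) ?(ltW (cside_gt0 _ _))//=.
apply: lee_wpmul2l; first by rewrite lee_fin invr_ge0 (ltW (cvol_gt0 _)).
apply: ge0_subset_integral => //; [exact: measurable_cell|exact: measurable_cube| |].
- by apply/measurable_EFinP/measurable_funTS; exact: measurableT_comp.
- exact: cell_cube.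
Qed.

(** Numbers that are not codes are sent to a fixed cell, so cells may repeat; only surjectivity
    matters for what follows. *)
Definition cell_enum (n : nat) : cellidx d :=
  odflt ([ffun=> false], 0%R, [ffun=> 0%R]) (unpickle n).

Lemma cell_enum_surj c : exists n, cell_enum n = c.
Proof. by exists (pickle c); rewrite /cell_enum pickleK. Qed.

Definition cell_max f N : V -> R :=
  pmax (fun n => cell R (cell_enum n)) (cavg f \o cell_enum) N.

(** A cube with average above t sits in a cell of side at most 6 times its own, whose average is
    smaller by a factor of at most 6^d. The inequality t < M f x is strict because the supremum may
    not be attained. *)
Lemma maximal_cell_max f x (t : R) : measurable_fun setT f -> cell_integrable f ->
  t%:E < maximal_cube mu f x ->
  exists N, (t <= 6 ^+ d * cell_max f N x)%R.
Proof.
move=> mf fc /maximal_gtP[a [l [l0 ax]]].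
have [c [ac cl]] := cube_sub_cell a l0.
have sub : \int[mu]_(y in cube a l) (`|f y|)%:E <=
    \int[mu]_(y in cell R c) (`|f y|)%:E.
  apply: ge0_subset_integral => //; [exact: measurable_cube|exact: measurable_cell|].
  by apply/measurable_EFinP/measurable_funTS; exact: measurableT_comp.
rewrite (lt_avg_cube lmu)// => /lt_le_trans/(_ sub).
rewrite integral_cell// lte_fin => tl.
have [n nc] := cell_enum_surj c; exists n.+1.
apply: (@le_trans _ _ (6 ^+ d * cavg f c)%R); last first.
  rewrite ler_wpM2l ?exprn_ge0//.
  have := @pmax_ge _ _ _ (fun n => cell R (cell_enum n)) (cavg f \o cell_enum) n n.+1 x.
  rewrite [(cavg f \o cell_enum) n]/= nc indicE mem_set ?mulr1; last exact: ac.
  by apply; exact: ltnSn.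
rewrite -(ler_pM2r (_ : 0 < l ^+ d)%R) ?exprn_gt0//.
apply: (le_trans (ltW tl)); rewrite mulrAC -exprMn ler_wpM2r ?cavg_ge0//.
by rewrite lerXn2r// nnegrE ?mulr_ge0 ?(ltW l0) ?(ltW (cside_gt0 _ _)).
Qed.

Lemma pmax_attained (Q : nat -> set V) (b : nat -> R) k x :
  pmax Q b k x = 0%R \/ exists2 i, (i < k)%N & pmax Q b k x = (b i * \1_(Q i) x)%R.
Proof.
elim: k => [|k ih] /=; first by left.
have [h|h] := leP (pmax Q b k x) (b k * \1_(Q k) x)%R; first by right; exists k.
case: ih => [->|[i ik ->]]; first by left.
by right; exists i => //; rewrite ltnS ltnW.
Qed.

(** Decreasing generation puts larger cells first, the order in which the nested estimates run.
    Sorting indices instead of cells allows several indices to share a cell. *)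
Definition level_sorted (I : Type) (c : I -> cellidx d) (s : seq I) :=
  sort (fun i j => (c j).1.2 <= (c i).1.2)%R s.

Lemma level_sorted_nested (I : eqType) (c : I -> cellidx d) (s : seq I) i0 alpha i j :
  {in s, forall i, (c i).1.1 = alpha} ->
  let t := level_sorted c s in
  (i < j < size t)%N ->
  cell R (c (nth i0 t j)) `<=` cell R (c (nth i0 t i)) \/
  cell R (c (nth i0 t i)) `&` cell R (c (nth i0 t j)) = set0.
Proof.
move=> salpha t /andP[ij jt].
have mem_s k : (k < size t)%N -> nth i0 t k \in s.
  by move=> kt; rewrite -(mem_sort (fun i j => (c j).1.2 <= (c i).1.2)%R) mem_nth.
apply: cell_nested.
  by rewrite !salpha ?mem_s// (ltn_trans ij).
have tr : transitive (fun i j => (c j).1.2 <= (c i).1.2)%R.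
  by move=> y x z /= xy yz; exact: le_trans yz xy.
have so : sorted (fun i j => (c j).1.2 <= (c i).1.2)%R t.
  by apply: sort_sorted => x y; exact: le_total.
by apply: (sorted_ltn_nth tr i0 so i j); rewrite ?inE//; exact: ltn_trans ij jt.
Qed.

End cell_averages.

(** * The maximal function at power r in X' *)

Section weighted_bounds.
Variables (R : realType) (d : nat).
Local Notation V := (Rd R d).
Variable mu : {measure set V -> \bar R}.
Hypothesis lmu : is_lebesgue mu.
Variable X : fnorm R d.
Hypothesis qX : is_qBfs mu X.
Variable m : R.
Hypothesis bX : bounded_with mu X (maximal_cube mu) m.
Variable s : R.
Hypothesis s0 : (0 < s)%R.
Implicit Types f g h : V -> R.

Local Notation K := (kothe mu X).
Local Notation M := (maximal_cube mu).

Let Xhom := qbfs_homogeneous qX.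
Let Xcube := qbfs_cube_regular lmu qX bX.
Let K0 g : 0 <= K g. Proof. exact: kothe_ge0. Qed.
Let m1 : (1 <= m)%R. Proof. exact: (opnorm_ge1 lmu qX bX). Qed.
Let s10 : (0 < s + 1)%R. Proof. by rewrite addr_gt0. Qed.

(** On a cube |f| <= 1 + |f|^(s+1), and the last term is integrable there by duality with the
    indicator of the cube, an element of X. *)
Lemma kothe_cell_integrable f : measurable_fun setT f ->
  K (fun x => `|f x| `^ (s + 1))%R < +oo -> cell_integrable mu f.
Proof.
move=> mf Kf c; set Q := cube (corner R c) (cside R c).
have c0 := cside_gt0 R c.
have mQ : measurable Q by exact: measurable_cube.
have mI : measurable_fun setT (\1_Q : V -> R) by exact: measurable_indic.
have mp := measurable_abs_powR (s + 1) mf.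
have /andP[X0 Xfin] := Xcube (corner R c) c0.
have XQ := inspace_cube Xcube (corner R c) c0.
apply: (@le_lt_trans _ _ (\int[mu]_x ((\1_Q x)%:E +
    (`|\1_Q x * `|f x| `^ (s + 1)|)%:E))).
  rewrite -(ge0_integral_mulindic mu _ (@measurable_cell R d c)).
  apply: ge0_le_integral => //.
  - apply: emeasurable_funM; apply/measurable_EFinP; last exact: measurableT_comp.
    by apply: measurable_indic; exact: measurable_cell.
  - by apply: emeasurable_funD; [exact/measurable_EFinP|exact: measurable_abs_mul].
  move=> x _; rewrite [\1_(cell R c) x]indicE.
  case: (boolP (x \in cell R c)) => [|_].
    rewrite inE => /cell_cube xQ; rewrite indicE mem_set// !mul1r mul1e.
    rewrite (ger0_norm (powR_ge0 _ _)) -EFinD lee_fin.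
    have [f1|f1] := leP `|f x|%R 1%R.
      by rewrite (le_trans f1)// lerDl powR_ge0.
    rewrite (le_trans (le1r_powR (ltW f1) (_ : 1 <= s + 1)%R))// ?lerDr//.
    exact: ltW.
  by rewrite mul0e -EFinD lee_fin addr_ge0.
rewrite ge0_integralD//; last 2 first.
- exact/measurable_EFinP.
- exact: measurable_abs_mul.
rewrite integral_indic// setIT; apply: lte_add_pinfty.
  by rewrite (lebesgue_cube lmu) ?(ltW c0)// ltry.
apply: (@le_lt_trans _ _ (X (\1_Q) * K (fun x => `|f x| `^ (s + 1))%R)).
  by apply: (kothe_hoelder Xhom (qbfs_definite qX)) => //; exact: ltW.
have /fineK <- : X (\1_Q) \is a fin_num by rewrite gt0_fin_numE.
have /fineK <- : K (fun x => `|f x| `^ (s + 1))%R \is a fin_num.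
  by rewrite ge0_fin_numE.
by rewrite -EFinM ltry.
Qed.

Definition grid_seq N (alpha : {ffun 'I_d -> bool}) : seq (cellidx d) :=
  level_sorted id [seq c <- [seq cell_enum d i | i <- iota 0 N] | c.1.1 == alpha].

Definition grid_max f N alpha : V -> R :=
  let t := grid_seq N alpha in
  pmax (fun k => cell R (nth (cell_enum d 0) t k))
       (fun k => cavg mu f (nth (cell_enum d 0) t k)) (size t).

Lemma measurable_grid_max f N alpha : measurable_fun setT (grid_max f N alpha).
Proof. by apply: measurable_pmax => k; exact: measurable_cell. Qed.

Lemma measurable_cell_max f N : measurable_fun setT (cell_max mu f N).
Proof. by apply: measurable_pmax => k; exact: measurable_cell. Qed.

Lemma kothe_grid_max f N alpha : measurable_fun setT f ->
  K (fun x => `|f x| `^ (s + 1))%R < +oo ->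
  K (fun x => grid_max f N alpha x `^ (s + 1))%R <=
  (2 `^ (s + 1) * ((s + 1) / s) * m)%:E * K (fun x => `|f x| `^ (s + 1))%R.
Proof.
move=> mf Kf; have fc := kothe_cell_integrable mf Kf.
apply: kothe_le => h Xh h1; have mh : measurable_fun setT h by case: Xh.
set t := grid_seq N alpha.
have tnest := @level_sorted_nested R d _ id
  [seq c <- [seq cell_enum d i | i <- iota 0 N] | c.1.1 == alpha] (cell_enum d 0) alpha.
rewrite (eq_integral (fun x => (grid_max f N alpha x `^ (s + 1) * `|h x|)%:E));
  last first.
  by move=> x _; rewrite normrM mulrC (ger0_norm (powR_ge0 _ _)).
apply: le_trans (@nested_max_bound _ _ _ mu (size t)
  (fun k => cell R (nth (cell_enum d 0) t k))
  (fun k => cvol R (nth (cell_enum d 0) t k)) _ _ _ (fun x => `|h x|)%R (M h)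
  _ _ _ _ _ s s0 (fun x => `|f x|)%R
  (fun k => cavg mu f (nth (cell_enum d 0) t k)) _ _ _ _ _) _.
- by move=> k; exact: measurable_cell.
- by move=> i j ij; apply: tnest => // c; rewrite mem_filter => /andP[/eqP].
- by move=> k; exact: cvol_gt0.
- by move=> x.
- exact: measurableT_comp.
- exact: measurable_maximal.
- by move=> x; exact: maximal_ge0.
- by move=> k x _ cx; exact: cell_average_le_maximal.
- exact: measurableT_comp.
- by move=> x.
- by move=> k; exact: cavg_ge0.
- by move=> k _; rewrite (lebesgue_cell lmu).
- by move=> k _; rewrite integral_cell.
rewrite [X in _ <= X * _]EFinM -muleA; apply: lee_wpmul2l.
  by rewrite lee_fin mulr_ge0 ?powR_ge0// divr_ge0// ltW.
by apply: (integral_mul_maximal_le lmu qX bX) => //; exact: measurable_abs_powR.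
Qed.

Lemma card_shifts : #|{ffun 'I_d -> bool}| = (2 ^ d)%N.
Proof. by rewrite card_ffun card_bool card_ord. Qed.

(** The maximum over all grids is attained by a cell of one grid, so its power is one of those
    summed on the right, or smaller. *)
Lemma cell_max_le_grid f N x :
  (cell_max mu f N x `^ (s + 1) <= \sum_alpha grid_max f N alpha x `^ (s + 1))%R.
Proof.
rewrite /cell_max; set Q := fun n => _; set b := _ \o _.
have [->|[i iN ->]] := pmax_attained Q b N x.
  by rewrite powR0 ?gt_eqF// sumr_ge0// => ? _; exact: powR_ge0.
rewrite (bigD1 (cell_enum d i).1.1)//=.
apply: le_trans (_ : _ <= grid_max f N (cell_enum d i).1.1 x `^ (s + 1))%R _; last first.
  by rewrite lerDl sumr_ge0// => ? _; exact: powR_ge0.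
rewrite ge0_ler_powR ?nnegrE ?(ltW s10)//.
- by rewrite mulr_ge0// cavg_ge0.
- exact: pmax_ge0.
have : cell_enum d i \in grid_seq N (cell_enum d i).1.1.
  by rewrite mem_sort mem_filter eqxx; apply: map_f; rewrite mem_iota.
move=> /(nthP (cell_enum d 0))[k kt ek].
have := @pmax_ge _ _ _
  (fun k => cell R (nth (cell_enum d 0) (grid_seq N (cell_enum d i).1.1) k))
  (fun k => cavg mu f (nth (cell_enum d 0) (grid_seq N (cell_enum d i).1.1) k))
  k _ x kt.
by rewrite ek.
Qed.

Lemma kothe_cell_max f N : measurable_fun setT f ->
  K (fun x => `|f x| `^ (s + 1))%R < +oo ->
  K (fun x => cell_max mu f N x `^ (s + 1))%R <=
  (2 ^+ d * (2 `^ (s + 1) * ((s + 1) / s) * m))%:E *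
  K (fun x => `|f x| `^ (s + 1))%R.
Proof.
move=> mf Kf.
have mp (u : V -> R) : measurable_fun setT u ->
    measurable_fun setT (fun x => u x `^ (s + 1))%R.
  by move=> mu_; exact: measurableT_comp (measurable_powR _) mu_.
apply: (@le_trans _ _ (K (fun x => \sum_alpha grid_max f N alpha x `^ (s + 1))%R)).
  apply: kothe_mono.
  - by apply: mp; exact: measurable_cell_max.
  - by apply: measurable_sum => alpha; apply: mp; exact: measurable_grid_max.
  - move=> x; rewrite !ger0_norm ?powR_ge0//; first exact: cell_max_le_grid.
    by rewrite sumr_ge0// => ? _; exact: powR_ge0.
apply: le_trans (kothe_sum _ _ _ _) _.
  by move=> alpha; apply: mp; exact: measurable_grid_max.
apply: (le_trans (lee_sum _ (fun alpha _ => kothe_grid_max N alpha mf Kf))).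
rewrite [X in _ <= X * _]EFinM -muleA; set B := (_ * m)%:E * _.
have Bfin : B \is a fin_num.
  by rewrite fin_numM// ge0_fin_numE.
rewrite -(fineK Bfin) sumEFin -EFinM lee_fin sumr_const card_shifts.
by rewrite mulrC -natrX mulr_natr.
Qed.

(** In 2 * 6^d, the 6^d compares cubes with cells, and the 2 gives room: psi/2 lies strictly below M
    f wherever psi > 0, so a finite stage [cell_max mu f N] already dominates it. *)
Lemma kothe_maximal f (psi : V -> R) : measurable_fun setT f ->
  K (fun x => `|f x| `^ (s + 1))%R < +oo -> measurable_fun setT psi ->
  (forall x, 0 <= psi x)%R -> (forall x, (psi x)%:E <= M f x) ->
  K (fun x => psi x `^ (s + 1))%R <=
  ((2 * 6 ^+ d) `^ (s + 1) * (2 ^+ d * (2 `^ (s + 1) * ((s + 1) / s) * m)))%:E *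
  K (fun x => `|f x| `^ (s + 1))%R.
Proof.
move=> mf Kf mpsi psi0 psiM; have fc := kothe_cell_integrable mf Kf.
set C := (2 * 6 ^+ d : R)%R; have C0 : (0 <= C)%R by rewrite mulr_ge0// exprn_ge0.
have mp (u : V -> R) : measurable_fun setT u ->
    measurable_fun setT (fun x => u x `^ (s + 1))%R.
  by move=> mu_; exact: measurableT_comp (measurable_powR _) mu_.
apply: kothe_le => h Xh h1; have mh : measurable_fun setT h by case: Xh.
apply: (@integral_le_of_eventually _ _ _ mu _
    (fun N x => (`|h x * (C * cell_max mu f N x) `^ (s + 1)|)%:E)).
- by apply: measurable_abs_mul => //; exact: mp.
- by move=> x; rewrite lee_fin.
- move=> N; apply: measurable_abs_mul => //; apply: mp.
  by apply: measurable_funM => //; exact: measurable_cell_max.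
- by move=> N x; rewrite lee_fin.
- move=> x i j ij; rewrite lee_fin !normrM ler_wpM2l// !ger0_norm ?powR_ge0//.
  rewrite ge0_ler_powR ?nnegrE ?(ltW s10) ?mulr_ge0 ?pmax_ge0//.
  by rewrite ler_wpM2l// le_pmax.
- move=> x; have [N psiN] : exists N, (psi x <= C * cell_max mu f N x)%R.
    have := psi0 x; rewrite le_eqVlt => /predU1P[<-|psix].
      by exists 0%N; rewrite mulr0.
    have [|N hN] := @maximal_cell_max _ _ _ lmu f x (psi x / 2)%R mf fc.
      by apply: lt_le_trans (psiM x); rewrite lte_fin; lra.
    by exists N; rewrite /C; lra.
  exists N; rewrite lee_fin !normrM ler_wpM2l// !ger0_norm ?powR_ge0//.
  by rewrite ge0_ler_powR ?nnegrE ?(ltW s10) ?mulr_ge0 ?pmax_ge0.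
move=> N; apply: (@le_trans _ _ (K (fun x => C `^ (s + 1) * cell_max mu f N x `^ (s + 1))%R)).
  rewrite (_ : (fun x => C `^ (s + 1) * cell_max mu f N x `^ (s + 1))%R =
    (fun x => (C * cell_max mu f N x) `^ (s + 1))%R); first exact: kothe_ub.
  by apply/funext => x; rewrite powRM// pmax_ge0.
have C1 : (0 < C `^ (s + 1))%R by rewrite powR_gt0// mulr_gt0// exprn_gt0.
have mc := mp _ (measurable_cell_max f N).
rewrite (kotheZ mu X C1 mc).
rewrite [X in _ <= X * _]EFinM -muleA lee_pmul2l ?lte_fin//.
exact: kothe_cell_max.
Qed.

End weighted_bounds.

(** * The adjoint operator A in X' *)

Section sparse_form_bounds.
Variables (R : realType) (d : nat).
Local Notation V := (Rd R d).
Variable mu : {measure set V -> \bar R}.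
Hypothesis lmu : is_lebesgue mu.
Variable X : fnorm R d.
Hypothesis qX : is_qBfs mu X.
Variable m : R.
Hypothesis bX : bounded_with mu X (maximal_cube mu) m.
Variable s : R.
Hypothesis s0 : (0 < s)%R.
Implicit Types f g h : V -> R.

Local Notation K := (kothe mu X).
Local Notation M := (maximal_cube mu).

Let Xhom := qbfs_homogeneous qX.
Let Xcube := qbfs_cube_regular lmu qX bX.
Let K0 g : 0 <= K g. Proof. exact: kothe_ge0. Qed.
Let m1 : (1 <= m)%R. Proof. exact: (opnorm_ge1 lmu qX bX). Qed.
Let s10 : (0 < s + 1)%R. Proof. by rewrite addr_gt0. Qed.

Let mp (u : V -> R) (p : R) : measurable_fun setT u ->
  measurable_fun setT (fun x => u x `^ p)%R.
Proof. by move=> mu_; exact: measurableT_comp (measurable_powR _) mu_. Qed.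

Variables (I : eqType) (c : I -> cellidx d) (E : I -> set V).
Hypothesis mE : forall i, measurable (E i).
Hypothesis EQ : forall i, E i `<=` cell R (c i).
Hypothesis Edisj : forall i j, i <> j -> E i `&` E j = set0.

Variable g : V -> R.
Hypothesis mg : measurable_fun setT g.
Hypothesis g0 : forall x, (0 <= g x)%R.
Hypothesis Kg : K (fun x => g x `^ (s + 1))%R < +oo.

(** Coefficient of A g on the i-th cell. The index type stays abstract: it is the naturals for (b)
    and the cubes of the sparse family for (c), where distinct cubes may be assigned the same
    cell. *)
Definition lin_coef i : R :=
  ((cvol R (c i))^-1 * fine (\int[mu]_(x in E i) (g x)%:E))%R.

Lemma lin_coef_ge0 i : (0 <= lin_coef i)%R.
Proof.
rewrite mulr_ge0 ?invr_ge0 ?(ltW (cvol_gt0 _ _))// fine_ge0//.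
by apply: integral_ge0 => x _; rewrite lee_fin.
Qed.

Lemma integral_lin_coef i :
  \int[mu]_(x in E i) (g x)%:E = (cvol R (c i) * lin_coef i)%:E.
Proof.
have I0 : 0 <= \int[mu]_(x in E i) (g x)%:E.
  by apply: integral_ge0 => x _; rewrite lee_fin.
rewrite mulrA divff ?gt_eqF ?cvol_gt0// mul1r fineK// ge0_fin_numE//.
have absE : (fun x => `|g x| `^ (s + 1))%R = (fun x => g x `^ (s + 1))%R.
  by apply/funext => x; rewrite ger0_norm.
have := @kothe_cell_integrable _ _ _ lmu _ qX _ bX _ s0 g mg _ (c i).
rewrite absE => /(_ Kg); apply: le_lt_trans.
have -> : \int[mu]_(y in cell R (c i)) (`|g y|)%:E =
    \int[mu]_(y in cell R (c i)) (g y)%:E.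
  by apply: eq_integral => x _; rewrite ger0_norm.
apply: ge0_subset_integral; [exact: mE|exact: measurable_cell| |
  by move=> x _; rewrite lee_fin|exact: EQ].
exact/measurable_EFinP/measurable_funTS.
Qed.

Definition lin_sum (t : seq I) (x : V) : R :=
  (\sum_(i <- t) lin_coef i * \1_(cell R (c i)) x)%R.

Lemma lin_sum_ge0 t x : (0 <= lin_sum t x)%R.
Proof. by apply: sumr_ge0 => i _; rewrite mulr_ge0// lin_coef_ge0. Qed.

Lemma measurable_lin_sum t : measurable_fun setT (lin_sum t).
Proof.
apply: measurable_sum => i; apply: measurable_funM => //.
by apply: measurable_indic; exact: measurable_cell.
Qed.

Lemma cells_sub_big_cube (t : seq I) :
  exists n, forall i, i \in t -> cell R (c i) `<=` big_cube R d n.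
Proof.
elim: t => [|i t [n hn]]; first by exists 0%N.
have [n' hn'] := cube_sub_big_cube (corner R (c i)) (ltW (cside_gt0 R (c i))).
exists (maxn n n') => j; rewrite inE => /predU1P[->|jt].
  apply: subset_trans (subset_big_cube (leq_maxr n n')).
  by apply: subset_trans hn'; exact: cell_cube.
by apply: subset_trans (subset_big_cube (leq_maxl n n')); exact: hn.
Qed.

(** A finite combination of indicators of cells is bounded and supported in one centred cube, whose
    indicator has finite norm in X'. This is the a priori finiteness needed for absorption. *)
Lemma kothe_lin_sum_lty t : K (fun x => lin_sum t x `^ (s + 1))%R < +oo.
Proof.
have [n tn] := cells_sub_big_cube t.
have n0 : (0 < 2 * n.+1%:R :> R)%R by rewrite mulr_gt0.
have mI : measurable_fun setT (\1_(big_cube R d n) : V -> R).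
  by apply: measurable_indic; exact: measurable_big_cube.
(* The added 1 makes the scaling factor positive, as [kotheZ] requires. *)
pose A := (\sum_(i <- t) lin_coef i + 1)%R.
have A0 : (0 < A)%R.
  by rewrite ltr_wpDl// sumr_ge0// => i _; exact: lin_coef_ge0.
have A1 : (0 < A `^ (s + 1))%R by rewrite powR_gt0.
apply: (@le_lt_trans _ _ (K (fun x => A `^ (s + 1) * \1_(big_cube R d n) x)%R)).
  apply: kothe_mono; first by apply: mp; exact: measurable_lin_sum.
    exact: measurable_funM.
  move=> x; rewrite !ger0_norm ?powR_ge0 ?mulr_ge0 ?powR_ge0//.
  rewrite indicE; case: (boolP (x \in big_cube R d n)) => xn.
    rewrite mulr1 ge0_ler_powR ?nnegrE ?lin_sum_ge0 ?(ltW A0) ?(ltW s10)//.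
    apply: (@le_trans _ _ (\sum_(i <- t) lin_coef i)%R); last by rewrite lerDl.
    apply: ler_sum => i _; rewrite -[leRHS]mulr1.
    apply: ler_wpM2l; first exact: lin_coef_ge0.
    by rewrite indicE; case: (_ \in _).
  rewrite mulr0 [lin_sum t x]big1_seq ?powR0 ?gt_eqF// => i /andP[_ it].
  rewrite indicE memNset ?mulr0// => xi.
  by move: xn; rewrite notin_setE; apply; exact: tn xi.
rewrite (kotheZ mu X A1 mI).
have /andP[_ Kfin] := kothe_cube_regular lmu qX bX [tuple (- n.+1%:R)%R | i < d] n0.
have /fineK <- : K (\1_(big_cube R d n)) \is a fin_num by rewrite ge0_fin_numE.
by rewrite -EFinM ltry.
Qed.

(** The choice of e makes the coefficient of A on the right equal to 1/2; subtracting it leaves 2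
    (s+1) m e^(-s) B, the stated power. *)
Lemma absorb_half (A B : R) : let e := ((2 * (s + 1) * m)^-1)%R in
  (A <= (s + 1) * (m * (e * A + e^-1 `^ s * B)))%R ->
  (A <= (2 * (s + 1) * m) `^ (s + 1) * B)%R.
Proof.
move=> e Ale; have m0 : (0 < m)%R by exact: lt_le_trans m1.
have re : ((s + 1) * m * e = 2^-1)%R by rewrite /e; field; rewrite !gt_eqF.
move: Ale; rewrite /e invrK -/e (powRS s0); last first.
  by rewrite !mulr_ge0 ?(ltW s10) ?(ltW m0).
set q := ((2 * (s + 1) * m) `^ s)%R => Ale.
have : (A <= (s + 1) * m * e * A + (s + 1) * m * (q * B))%R.
  by apply: (le_trans Ale); rewrite le_eqVlt; apply/orP; left; apply/eqP; ring.
rewrite re => h.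
have -> : (2 * (s + 1) * m * q * B = 2 * ((s + 1) * m * (q * B)))%R by ring.
lra.
Qed.

(* With [u = lin_sum t], [r = s + 1] and norms in the Koethe dual, the pointwise
   bound [u^r <= r A(g u^s)], where [u = A g], gives
   [|u^r| <= r m |g u^s| <= |u^r| / 2 + C |g^r|]; then absorb. *)
Lemma kothe_lin_sum_grid t alpha : uniq t ->
  {in t, forall i, (c i).1.1 = alpha} ->
  K (fun x => lin_sum t x `^ (s + 1))%R <=
  ((2 * (s + 1) * m) `^ (s + 1))%:E * K (fun x => g x `^ (s + 1))%R.
Proof.
move=> ut talpha; set r := (s + 1)%R; set P := K (fun x => g x `^ r)%R.
have m0 : (0 < m)%R by exact: lt_le_trans m1.
have rm0 : (0 < r * m)%R by rewrite mulr_gt0.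
pose e := (2 * r * m)^-1%R.
have e0 : (0 < e)%R by rewrite invr_gt0 -mulrA mulr_gt0.
set u := lin_sum t; have mu_ : measurable_fun setT u by exact: measurable_lin_sum.
set U := K (fun x => u x `^ r)%R.
have Ufin : U \is a fin_num.
  by rewrite ge0_fin_numE; [exact: kothe_lin_sum_lty|exact: K0].
have Pfin : P \is a fin_num by rewrite ge0_fin_numE; [exact: Kg|exact: K0].
have u0 x : (0 <= u x)%R by exact: lin_sum_ge0.
have step h : inspace X h -> X h = 1 ->
    \int[mu]_x (`|h x * u x `^ r|)%:E <= r%:E * (m%:E * K (fun x => g x * u x `^ s)%R).
  move=> Xh h1; have mh : measurable_fun setT h by case: Xh.
  rewrite (eq_integral (fun x => (u x `^ r * `|h x|)%:E)); last first.
    by move=> x _; rewrite normrM mulrC (ger0_norm (powR_ge0 _ _)).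
  have le2 : r%:E * \int[mu]_x ((g x * u x `^ s)%:E * M h x) <=
      r%:E * (m%:E * K (fun x => g x * u x `^ s)%R).
    apply: lee_wpmul2l; first by rewrite lee_fin ltW.
    apply: (integral_mul_maximal_le lmu qX bX) => //.
      by apply: measurable_funM => //; exact: mp.
    by move=> x; rewrite mulr_ge0// powR_ge0.
  apply: le_trans le2.
  (* Indexing the sorted list by positions needs a default element, so the empty list is treated
     apart. *)
  case E0 : t => [|i0 t0].
    rewrite (eq_integral (cst 0)) ?integral0; last first.
      by move=> x _; rewrite /u E0 /lin_sum big_nil powR0 ?gt_eqF// mul0r.
    rewrite mule_ge0 ?lee_fin ?(ltW s10)// integral_ge0// => x _.
    by rewrite mule_ge0 ?maximal_ge0// lee_fin mulr_ge0// powR_ge0.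
  pose tt := level_sorted c t.
  have ptt : perm_eq tt t by exact: permEl (perm_sort _ _).
  have uE x : u x = psum (fun k => cell R (c (nth i0 tt k)))
      (fun k => lin_coef (nth i0 tt k)) (size tt) x.
    by rewrite /u /lin_sum -(perm_big _ ptt)/= (big_nth i0) big_mkord.
  have utt : uniq tt by rewrite (perm_uniq ptt).
  under eq_integral do rewrite uE.
  under [in leRHS]eq_integral do rewrite uE.
  apply: (@nested_sum_bound _ _ _ mu (size tt) _ (fun k => cvol R (c (nth i0 tt k)))
    _ _ _ (fun x => `|h x|)%R (M h) _ _ _ _ _ s s0 (fun k => E (nth i0 tt k))) => //.
  - by move=> k; exact: measurable_cell.
  - by move=> i j; exact: level_sorted_nested talpha.
  - by move=> k; exact: cvol_gt0.
  - exact: measurableT_comp.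
  - exact: measurable_maximal.
  - by move=> x; exact: maximal_ge0.
  - by move=> k x _ cx; exact: cell_average_le_maximal.
  - move=> i j it jt ij; apply: Edisj => /eqP; rewrite nth_uniq// => /eqP.
    exact: ij.
  - by move=> k; exact: lin_coef_ge0.
  - by move=> k _; exact: integral_lin_coef.
have mgu : measurable_fun setT (fun x => g x * u x `^ s)%R.
  by apply: measurable_funM => //; exact: mp.
have split_ : K (fun x => g x * u x `^ s)%R <= e%:E * U + (e^-1 `^ s)%:E * P.
  have es0 : (0 < e^-1 `^ s)%R by rewrite powR_gt0// invr_gt0.
  rewrite /U /P -(kotheZ mu X e0 (mp r mu_)) -(kotheZ mu X es0 (mp r mg)).
  apply: le_trans (kotheD mu X _ _); last 2 first.
  - by apply: measurable_funM => //; exact: mp.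
  - by apply: measurable_funM => //; exact: mp.
  apply: kothe_mono => //.
    by apply: measurable_funD; apply: measurable_funM => //; exact: mp.
  move=> x; rewrite !ger0_norm ?mulr_ge0 ?powR_ge0//.
    exact: mul_powR_le_split.
  by rewrite addr_ge0// mulr_ge0 ?powR_ge0// ltW.
have : U <= r%:E * (m%:E * (e%:E * U + (e^-1 `^ s)%:E * P)).
  apply: kothe_le => h Xh h1; apply: (le_trans (step h Xh h1)).
  apply: lee_wpmul2l; first by rewrite lee_fin ltW.
  by apply: lee_wpmul2l => //; rewrite lee_fin ltW.
rewrite -(fineK Ufin) -(fineK Pfin) -!EFinM !lee_fin.
exact: absorb_half.
Qed.

(** Each v j is at most the (s+1)-th root of the sum of powers. The crude constant is harmless: its
    theta-th root is the cardinality of J. *)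
Lemma powR_sum_le (J : finType) (v : J -> R) : (forall j, 0 <= v j)%R ->
  ((\sum_j v j) `^ (s + 1) <= #|J|%:R `^ (s + 1) * \sum_j v j `^ (s + 1))%R.
Proof.
move=> v0; set S := (\sum_j v j `^ (s + 1))%R.
have S0 : (0 <= S)%R by apply: sumr_ge0 => j _; exact: powR_ge0.
have vS j : (v j <= S `^ (s + 1)^-1)%R.
  have -> : v j = ((v j `^ (s + 1)) `^ (s + 1)^-1)%R.
    by rewrite -powRrM divff ?gt_eqF// powRr1.
  rewrite ge0_ler_powR ?nnegrE ?powR_ge0 ?invr_ge0 ?(ltW s10)//.
  by rewrite /S (bigD1 j)//= lerDl sumr_ge0// => i _; exact: powR_ge0.
have -> : S = ((S `^ (s + 1)^-1) `^ (s + 1))%R.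
  by rewrite -powRrM mulVf ?gt_eqF// powRr1.
rewrite -powRM ?powR_ge0// ge0_ler_powR ?nnegrE ?(ltW s10) ?mulr_ge0 ?powR_ge0//.
  by apply: sumr_ge0.
apply: (le_trans (ler_sum _ (fun j _ => vS j))).
by rewrite sumr_const mulr_natl.
Qed.

(** The family splits into 2^d families, each in one grid. The power of 2^d comes from the power of
    a sum, the plain 2^d from adding the norms. *)
Lemma kothe_lin_sum t : uniq t ->
  K (fun x => lin_sum t x `^ (s + 1))%R <=
  ((2 ^+ d) `^ (s + 1) * (2 ^+ d * (2 * (s + 1) * m) `^ (s + 1)))%:E *
  K (fun x => g x `^ (s + 1))%R.
Proof.
move=> ut; set P := K (fun x => g x `^ _)%R.
have Pfin : P \is a fin_num by rewrite ge0_fin_numE; [exact: Kg|exact: K0].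
pose ta (alpha : {ffun 'I_d -> bool}) := [seq i <- t | (c i).1.1 == alpha].
have lE x : lin_sum t x = (\sum_alpha lin_sum (ta alpha) x)%R.
  rewrite /lin_sum (partition_big (fun i => (c i).1.1) xpredT)//=.
  by apply: eq_bigr => alpha _; rewrite big_filter.
have mta alpha := mp (s + 1) (measurable_lin_sum (ta alpha)).
have D0 : (0 < (2 ^+ d : R) `^ (s + 1))%R by rewrite powR_gt0// exprn_gt0.
have msum : measurable_fun setT (fun x => \sum_alpha lin_sum (ta alpha) x `^ (s + 1))%R.
  by apply: measurable_sum => alpha.
apply: (@le_trans _ _ (K (fun x => (2 ^+ d) `^ (s + 1) *
    \sum_alpha lin_sum (ta alpha) x `^ (s + 1))%R)).
  apply: kothe_mono.
  - by apply: mp; exact: measurable_lin_sum.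
  - exact: measurable_funM.
  move=> x; rewrite !ger0_norm ?powR_ge0//; last first.
    by rewrite mulr_ge0 ?powR_ge0// sumr_ge0// => ? _; exact: powR_ge0.
  have := @powR_sum_le {ffun 'I_d -> bool} (fun alpha => lin_sum (ta alpha) x)
    (fun alpha => lin_sum_ge0 _ _).
  by rewrite lE card_shifts natrX.
rewrite (kotheZ mu X D0 msum) [X in _ <= X * _]EFinM -muleA lee_pmul2l ?lte_fin//.
apply: (le_trans (kothe_sum mu X _ mta)).
apply: (@le_trans _ _ (\sum_(alpha : {ffun 'I_d -> bool})
    ((2 * (s + 1) * m) `^ (s + 1))%:E * P)).
  apply: lee_sum => alpha _; apply: (@kothe_lin_sum_grid _ alpha).
    exact: filter_uniq.
  by move=> i; rewrite mem_filter => /andP[/eqP].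
rewrite -(fineK Pfin) -EFinM sumEFin -EFinM lee_fin sumr_const card_shifts.
by rewrite -[leRHS]mulrA -natrX [leRHS]mulr_natl.
Qed.

End sparse_form_bounds.

(** * Operator norms and operators with extended-real values *)

Section norm_bounds.
Variables (R : realType) (d : nat).
Local Notation V := (Rd R d).
Variable mu : {measure set V -> \bar R}.
Variable N : fnorm R d.
Hypothesis N0 : forall f, 0 <= N f.

Lemma le_bounded_with (T : (V -> R) -> V -> \bar R) (C C' : R) : (C <= C')%R ->
  bounded_with mu N T C -> bounded_with mu N T C'.
Proof.
move=> CC' bC f Nf; have [mT Tfin TC] := bC f Nf; split=> //.
by apply: (le_trans TC); apply: lee_wpmul2r => //; rewrite lee_fin.
Qed.

(** For each fixed f the admissible constants form a closed condition, so the infimum is attained.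
    This allows m to be the operator norm itself. *)
Lemma bounded_with_opnorm (T : (V -> R) -> V -> \bar R) :
  (exists C : R, bounded_with mu N T C) ->
  bounded_with mu N T (fine (opnorm mu N T)).
Proof.
move=> [C0 bC0]; set op := opnorm mu N T.
pose C1 := Num.max C0 0%R.
have C10 : (0 <= C1)%R by rewrite le_max lexx orbT.
have bC1 : bounded_with mu N T C1 by apply: le_bounded_with bC0; rewrite le_max lexx.
have opC (C : R) : (0 <= C)%R -> bounded_with mu N T C -> op <= C%:E.
  by move=> C0' bC; apply: ereal_inf_lbound; exists C.
have op0 : 0 <= op.
  by apply: le_ereal_inf_tmp => _ [C [C0' _] <-]; rewrite lee_fin.
have opfin : op \is a fin_num.
  by rewrite ge0_fin_numE// (le_lt_trans (opC _ C10 bC1)) ?ltry.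
move=> f Nf; have [mT Tfin TC] := bC1 f Nf; split=> //.
have Nfin : N f \is a fin_num by rewrite ge0_fin_numE//; case: Nf.
rewrite fineK//; move: (N0 f); rewrite le_eqVlt => /predU1P[e|Npos].
  by move: TC; rewrite -e !mule0.
have a0 : (0 < fine (N f))%R by rewrite fine_gt0// Npos; case: Nf.
rewrite -(fineK Nfin) -lee_pdivrMr//.
apply: le_ereal_inf_tmp => _ [C [C0' bC] <-].
by rewrite lee_pdivrMr// fineK//; have [] := bC f Nf.
Qed.

Hypothesis Nhom : forall f (c : R), (0 < c)%R -> measurable_fun setT f ->
  N (fun x => c * f x)%R = c%:E * N f.
Hypothesis Ndef : definite mu N.

(* Applied to [psi = n 1_{W = +oo}], the bound forces [W] to be finite almost
   everywhere. *)
Lemma in_with_norm_intro (W : V -> \bar R) (B : \bar R) : measurable_fun setT W ->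
  (forall x, 0 <= W x) -> B < +oo ->
  (forall psi : V -> R, measurable_fun setT psi -> (forall x, 0 <= psi x)%R ->
    (forall x, (psi x)%:E <= W x) -> N psi <= B) ->
  in_with_norm mu N W B.
Proof.
move=> mW W0 By NB; split=> //; last first.
  apply: NB; first exact: measurableT_comp.
    by move=> x; rewrite fine_ge0.
  move=> x; have := W0 x; by case: (W x) => [r| |] //= _; rewrite leey.
pose Z := W @^-1` [set +oo].
have mZ : measurable Z by rewrite -[Z]setTI; exact: mW.
have mI : measurable_fun setT (\1_Z : V -> R) by exact: measurable_indic.
have bound (c : R) : (0 < c)%R -> c%:E * N (\1_Z) <= B.
  move=> c0; rewrite -Nhom//; apply: NB.
  - exact: measurable_funM.
  - by move=> x; rewrite mulr_ge0// ltW.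
  - move=> x; rewrite indicE; case: (boolP (x \in Z)) => [|_]; last by rewrite mulr0.
    by rewrite inE => ->; rewrite leey.
have Z0 : N (\1_Z) = 0.
  apply/eqP; rewrite eq_le N0 andbT leNgt; apply/negP => Zpos.
  have B1 := bound 1%R ltr01; rewrite mul1e in B1.
  have Nfin : N (\1_Z) \is a fin_num by rewrite gt0_fin_numE// (le_lt_trans B1).
  have Bfin : B \is a fin_num.
    by rewrite ge0_fin_numE// (le_trans (N0 _) B1).
  have n0 : (0 < fine (N (\1_Z)))%R by rewrite fine_gt0// Zpos (le_lt_trans B1).
  have b0 : (0 <= fine B)%R by rewrite fine_ge0// (le_trans (N0 _) B1).
  (* With this factor the bound would read B + 1 <= B. *)
  have c0 : (0 < (fine B + 1) / fine (N (\1_Z)))%R by rewrite divr_gt0// ltr_wpDl.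
  have := bound _ c0.
  rewrite -(fineK Nfin) -(fineK Bfin) -EFinM lee_fin /= divfK ?gt_eqF//.
  by rewrite gerDl ler10.
apply: filterS (Ndef mI Z0) => x /=; rewrite indicE => Zx.
rewrite ge0_fin_numE// ltey; apply/eqP => Wx; move: Zx.
by rewrite mem_set// => /eqP; rewrite oner_eq0.
Qed.

End norm_bounds.

(** * The maximal function on (X')^theta *)

Section maximal_power_dual.
Variables (R : realType) (d : nat).
Local Notation V := (Rd R d).
Variable mu : {measure set V -> \bar R}.
Hypothesis lmu : is_lebesgue mu.
Variable X : fnorm R d.
Hypothesis qX : is_qBfs mu X.
Variable m : R.
Hypothesis bX : bounded_with mu X (maximal_cube mu) m.
Variable theta : R.
Hypothesis t01 : (0 < theta < 1)%R.

Local Notation K := (kothe mu X).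
Local Notation Y := (fpower (kothe mu X) theta).
Local Notation M := (maximal_cube mu).

Lemma theta_gt0 : (0 < theta)%R. Proof. by case/andP: t01. Qed.

Lemma pow_gap_gt0 : (0 < theta^-1 - 1)%R.
Proof. by case/andP: t01 => t0 t1; rewrite subr_gt0 invf_gt1. Qed.

Lemma pow_gapE : (theta^-1 - 1 + 1 = theta^-1)%R. Proof. exact: subrK. Qed.

Lemma kothe_X_ge0 g : 0 <= K g.
Proof. exact: (kothe_ge0 mu (qbfs_homogeneous qX) (qbfs_cube_regular lmu qX bX)). Qed.

Lemma kothe_X_definite : definite mu K.
Proof.
move=> g; exact: (kothe_definite (qbfs_homogeneous qX) (qbfs_cube_regular lmu qX bX)).
Qed.

Lemma Y_ge0 f : 0 <= Y f. Proof. exact: poweR_ge0. Qed.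

Lemma Y_homogeneous f (c : R) : (0 < c)%R -> measurable_fun setT f ->
  Y (fun x => c * f x)%R = c%:E * Y f.
Proof.
move=> c0 mf.
have c1 : (0 < c `^ theta^-1)%R by rewrite powR_gt0.
rewrite /fpower; have -> : (fun x => `|c * f x| `^ theta^-1)%R =
    (fun x => c `^ theta^-1 * `|f x| `^ theta^-1)%R.
  by apply/funext => x; rewrite normrM (gtr0_norm c0) powRM// ltW.
rewrite (kotheZ mu X c1 (measurable_abs_powR _ mf)).
rewrite poweRM ?lee_fin ?powR_ge0 ?kothe_X_ge0// poweR_EFin -powRrM.
by rewrite mulVf ?gt_eqF ?theta_gt0// powRr1// ltW.
Qed.

Lemma Y_definite : definite mu Y.
Proof. exact: (fpower_definite kothe_X_ge0 kothe_X_definite). Qed.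

(** Here r/s = 1 / (1 - theta). As r >= 1, the factors G and 1 / (1 - theta), both at least 1, are
    below their r-th powers, whereas m is exactly the r-th power of m^theta. *)
Lemma cst_maximal_Y_powR_ge (A G : R) : (0 < A)%R -> (1 <= G)%R -> (1 <= m)%R ->
  (A `^ theta^-1 *
    (G * (2 `^ theta^-1 * (theta^-1 / (theta^-1 - 1)) * m)) <=
   (2 * A * G / (1 - theta) * m `^ theta) `^ theta^-1)%R.
Proof.
move=> A0 G1 m1; have /andP[t0 t1] := t01.
have t1' : (0 < 1 - theta)%R by rewrite subr_gt0.
have G0 : (0 <= G)%R by exact: le_trans G1.
have m0 : (0 <= m)%R by exact: le_trans m1.
rewrite powRM ?powR_ge0// ?divr_ge0 ?mulr_ge0 ?(ltW A0) ?(ltW t1')//.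
rewrite -powRrM divff ?gt_eqF// powRr1//.
rewrite powRM ?mulr_ge0 ?invr_ge0 ?(ltW A0) ?(ltW t1')//.
rewrite powRM ?mulr_ge0 ?(ltW A0)// powRM ?(ltW A0)//.
have -> : (theta^-1 / (theta^-1 - 1) = (1 - theta)^-1)%R.
  by field; rewrite ?gt_eqF.
have r1 : (1 <= theta^-1)%R by rewrite invf_ge1// ltW.
have h1 : (G <= G `^ theta^-1)%R by exact: le1r_powR.
have h2 : ((1 - theta)^-1 <= (1 - theta)^-1 `^ theta^-1)%R.
  by apply: le1r_powR => //; rewrite invf_ge1//; lra.
rewrite [leLHS](_ : _ = (2 `^ theta^-1 * A `^ theta^-1 * G * (1 - theta)^-1 * m)%R);
  last by ring.
rewrite ler_wpM2r// ler_pM ?mulr_ge0 ?powR_ge0 ?invr_ge0 ?(ltW t1')//.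
by rewrite ler_wpM2l ?mulr_ge0 ?powR_ge0.
Qed.

(** The leading 2 is the root of 2^r, the factor 2 * 6^d is the passage from cubes to cells, and the
    last 2^d counts the grids. *)
Definition cst_maximal_Y : R := (2 * (2 * 6 ^+ d) * 2 ^+ d)%R.

Lemma maximal_Y_pointwise (f psi : V -> R) : inspace Y f -> measurable_fun setT psi ->
  (forall x, 0 <= psi x)%R -> (forall x, (psi x)%:E <= M f x) ->
  Y psi <= (cst_maximal_Y / (1 - theta) * m `^ theta)%:E * Y f.
Proof.
move=> [mf Yf] mpsi psi0 psiM.
have Kf := fpower_lty theta_gt0 Yf.
have /andP[t0 t1] := t01.
have m1 := opnorm_ge1 lmu qX bX.
have C0 : (0 <= cst_maximal_Y / (1 - theta) * m `^ theta)%R.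
  rewrite mulr_ge0 ?powR_ge0// divr_ge0 ?subr_ge0 ?(ltW t1)//.
  by rewrite /cst_maximal_Y !mulr_ge0// exprn_ge0.
apply: (fpower_le kothe_X_ge0 theta_gt0 C0).
have := @kothe_maximal _ _ _ lmu _ qX _ bX _ pow_gap_gt0 f psi mf.
rewrite pow_gapE => /(_ Kf mpsi psi0 psiM) bound.
have -> : (fun x => `|psi x| `^ theta^-1)%R = (fun x => psi x `^ theta^-1)%R.
  by apply/funext => x; rewrite ger0_norm.
apply: (le_trans bound); apply: lee_wpmul2r; first exact: kothe_X_ge0.
by rewrite lee_fin; apply: cst_maximal_Y_powR_ge => //; rewrite exprn_ege1// ler1n.
Qed.

Lemma bounded_maximal_Y : bounded_with mu Y M (cst_maximal_Y / (1 - theta) * m `^ theta)%R.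
Proof.
move=> f Yf; have [mf Yfy] := Yf.
apply: (in_with_norm_intro Y_ge0 Y_homogeneous Y_definite).
- exact: measurable_maximal.
- by move=> x; exact: maximal_ge0.
- have /fineK <- : Y f \is a fin_num by rewrite ge0_fin_numE// Y_ge0.
  by rewrite -EFinM ltry.
- by move=> psi; exact: maximal_Y_pointwise.
Qed.

End maximal_power_dual.

(** * The maximal function on [(X')^theta]' *)

Section maximal_dual_power_dual.
Variables (R : realType) (d : nat).
Local Notation V := (Rd R d).
Variable mu : {measure set V -> \bar R}.
Hypothesis lmu : is_lebesgue mu.
Variable X : fnorm R d.
Hypothesis qX : is_qBfs mu X.
Variable m : R.
Hypothesis bX : bounded_with mu X (maximal_cube mu) m.
Variable theta : R.
Hypothesis t01 : (0 < theta < 1)%R.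

Local Notation K := (kothe mu X).
Local Notation Y := (fpower (kothe mu X) theta).
Local Notation M := (maximal_cube mu).

Let K0 := kothe_X_ge0 lmu qX bX.
Let Y0 := @Y_ge0 R d mu X theta.
Let t0 := theta_gt0 t01.
Let Ydef := Y_definite lmu qX bX (theta := theta).

Lemma Y_hom : homogeneous Y.
Proof. by move=> f c c0 [mf _]; exact: (Y_homogeneous lmu qX bX t01). Qed.

Lemma Y_cube : cube_regular Y.
Proof. exact: (fpower_cube_regular t0 (kothe_cube_regular lmu qX bX)). Qed.

Lemma Ydual_ge0 g : 0 <= kothe mu Y g.
Proof. exact: (kothe_ge0 mu Y_hom Y_cube). Qed.

Lemma Ydual_definite : definite mu (kothe mu Y).
Proof. by move=> g; exact: (kothe_definite Y_hom Y_cube). Qed.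

Lemma Ydual_cell_integrable f : measurable_fun setT f -> kothe mu Y f < +oo ->
  cell_integrable mu f.
Proof.
move=> mf Kf c; set Q := cube (corner R c) (cside R c).
have c0 := cside_gt0 R c.
have mQ : measurable Q by exact: measurable_cube.
have /andP[X0 Xfin] := Y_cube (corner R c) c0.
have XQ := inspace_cube Y_cube (corner R c) c0.
apply: (@le_lt_trans _ _ (\int[mu]_x (`|\1_Q x * f x|)%:E)).
  rewrite -(ge0_integral_mulindic mu _ (@measurable_cell R d c)).
  apply: ge0_le_integral => //.
  - apply: emeasurable_funM; apply/measurable_EFinP; last exact: measurableT_comp.
    by apply: measurable_indic; exact: measurable_cell.
  - by apply: measurable_abs_mul => //; exact: measurable_indic.
  move=> x _; rewrite [\1_(cell R c) x]indicE.
  case: (boolP (x \in cell R c)) => [|_]; last by rewrite mul0e lee_fin.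
  by rewrite inE => /cell_cube xQ; rewrite indicE mem_set// mul1r mul1e.
apply: le_lt_trans (kothe_hoelder Y_hom Ydef (Y0 _) XQ mf) _.
have /fineK <- : Y (\1_Q) \is a fin_num by rewrite gt0_fin_numE.
have /fineK <- : kothe mu Y f \is a fin_num.
  by rewrite ge0_fin_numE; [exact: Kf|exact: Ydual_ge0].
by rewrite -EFinM ltry.
Qed.

(** Bounds the theta-th root of the constant in [kothe_lin_sum]; the factor 2^d that was not raised
    to the power r is enlarged to its r-th power first. *)
Definition cst_lin : R := (2 ^+ d * 2 ^+ d * (2 * theta^-1 * m))%R.

Lemma cst_lin_ge0 : (0 <= cst_lin)%R.
Proof.
have m1 := opnorm_ge1 lmu qX bX.
by rewrite /cst_lin !mulr_ge0 ?exprn_ge0 ?invr_ge0 ?(ltW t0)// (le_trans _ m1).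
Qed.

Lemma lin_sum_K (I : eqType) (c : I -> cellidx d) (E : I -> set V) (g : V -> R) t :
  (forall i, measurable (E i)) -> (forall i, E i `<=` cell R (c i)) ->
  (forall i j, i <> j -> E i `&` E j = set0) ->
  measurable_fun setT g -> (forall x, 0 <= g x)%R ->
  K (fun x => g x `^ theta^-1)%R < +oo -> uniq t ->
  K (fun x => lin_sum mu c E g t x `^ theta^-1)%R <=
  (cst_lin `^ theta^-1)%:E * K (fun x => g x `^ theta^-1)%R.
Proof.
move=> mE EQ Edisj mg g0 Kg ut; have m1 := opnorm_ge1 lmu qX bX.
have := @kothe_lin_sum _ _ _ lmu _ qX _ bX _ (pow_gap_gt0 t01) I c E mE EQ Edisj
  g mg g0.
rewrite pow_gapE => /(_ Kg t ut) bound.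
apply: (le_trans bound); apply: lee_wpmul2r; first exact: K0.
have m0 : (0 <= m)%R by rewrite (le_trans _ m1).
have G0 : (0 <= 2 ^+ d :> R)%R by rewrite exprn_ge0.
have q0 : (0 <= 2 * theta^-1 * m)%R by rewrite !mulr_ge0 ?invr_ge0 ?(ltW t0).
rewrite lee_fin /cst_lin (@powRM _ (2 ^+ d * 2 ^+ d)%R)//.
rewrite (@powRM _ (2 ^+ d)%R)// -[leRHS]mulrA.
apply: ler_wpM2l; first exact: powR_ge0.
apply: ler_wpM2r; first exact: powR_ge0.
apply: le1r_powR; first by rewrite exprn_ege1// ler1n.
by rewrite invf_ge1// ltW//; case/andP: t01.
Qed.

Lemma lin_sum_Y (I : eqType) (c : I -> cellidx d) (E : I -> set V) (g : V -> R) t :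
  (forall i, measurable (E i)) -> (forall i, E i `<=` cell R (c i)) ->
  (forall i j, i <> j -> E i `&` E j = set0) ->
  measurable_fun setT g -> (forall x, 0 <= g x)%R -> Y g < +oo -> uniq t ->
  Y (lin_sum mu c E g t) <= cst_lin%:E * Y g.
Proof.
move=> mE EQ Edisj mg g0 Yg ut; have Kg := fpower_lty t0 Yg.
have gE : (fun x => `|g x| `^ theta^-1)%R = (fun x => g x `^ theta^-1)%R.
  by apply/funext => x; rewrite ger0_norm.
apply: (fpower_le K0 t0 cst_lin_ge0); rewrite gE; rewrite gE in Kg.
have -> : (fun x => `|lin_sum mu c E g t x| `^ theta^-1)%R =
    (fun x => lin_sum mu c E g t x `^ theta^-1)%R.
  by apply/funext => x; rewrite ger0_norm// lin_sum_ge0.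
exact: lin_sum_K.
Qed.

(* The maximum is attained on disjoint sets [E_i] by the average over the [i]-th
   cell; the adjoint of this linearization is [lin_sum]. *)
Lemma cell_max_duality (f g : V -> R) N : measurable_fun setT f ->
  kothe mu Y f < +oo -> measurable_fun setT g -> (forall x, 0 <= g x)%R ->
  Y g < +oo ->
  \int[mu]_x (g x * cell_max mu f N x)%:E <= cst_lin%:E * Y g * kothe mu Y f.
Proof.
move=> mf Kf mg g0 Yg; have fc := Ydual_cell_integrable mf Kf.
pose b := cavg mu f \o cell_enum d.
have b0 i : (0 <= b i)%R by exact: cavg_ge0.
(* For i < N the maximum equals [b i] on [A i]; [seqDU] then makes these sets disjoint. *)
pose A i := cell R (cell_enum d i) `&` [set x | (cell_max mu f N x <= b i)%R].
have mA i : measurable (A i).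
  apply: measurableI; first exact: measurable_cell.
  rewrite -[X in measurable X]setTI; apply: measurable_fun_ler => //.
  exact: measurable_cell_max.
pose E := seqDU A.
have EA i : E i `<=` A i by move=> x [].
have mE i : measurable (E i).
  by apply: measurableD => //; exact: bigsetU_measurable.
have EQ i : E i `<=` cell R (cell_enum d i) by move=> x /EA[].
have Edisj i j : i <> j -> E i `&` E j = set0.
  move=> ij; have [//|ne] := eqVneq (E i `&` E j) set0.
  have := @trivIset_seqDU _ A i j Logic.I Logic.I.
  by move=> h; exfalso; apply: ij; apply: h; exact/set0P.
have Kg := fpower_lty t0 Yg.
have gE : (fun x => `|g x| `^ theta^-1)%R = (fun x => g x `^ theta^-1)%R.
  by apply/funext => x; rewrite ger0_norm.
pose a := lin_coef mu (cell_enum d) E g.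
have a0 i : (0 <= a i)%R by exact: lin_coef_ge0.
have aE i : \int[mu]_(x in E i) (g x)%:E = (cvol R (cell_enum d i) * a i)%:E.
  have := @integral_lin_coef _ _ _ lmu _ qX _ bX _ (pow_gap_gt0 t01) nat (cell_enum d)
    E mE EQ g mg g0.
  by rewrite pow_gapE -gE => /(_ Kg i).
have mEg : measurable_fun setT (fun x => (g x)%:E) by exact/measurable_EFinP.
have mEf : measurable_fun setT (fun x => (`|f x|)%:E).
  by apply/measurable_EFinP; exact: measurableT_comp.
have mcm := measurable_cell_max mu f N.
apply: (@le_trans _ _ (\int[mu]_x \sum_(k < N) (b k * \1_(E k) x)%:E * (g x)%:E)).
  apply: ge0_le_integral => //.
  - by move=> x _; rewrite lee_fin mulr_ge0// pmax_ge0.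
  - by apply/measurable_EFinP; exact: measurable_funM.
  - apply: emeasurable_sum => k; apply: emeasurable_funM => //.
    by apply/measurable_EFinP; apply: measurable_funM => //; exact: measurable_indic.
  move=> x _; rewrite -ge0_sume_distrl; last by move=> k _; rewrite lee_fin mulr_ge0.
  rewrite sumEFin -EFinM lee_fin mulrC ler_wpM2r//.
  have sum0 : (0 <= \sum_(k < N) b k * \1_(E k) x)%R.
    by apply: sumr_ge0 => k _; rewrite mulr_ge0.
  have cmE : cell_max mu f N x = pmax (fun n => cell R (cell_enum d n)) b N x by [].
  rewrite cmE.
  have [->//|[i iN]] := pmax_attained (fun n => cell R (cell_enum d n)) b N x.
  rewrite indicE; case: (boolP (x \in cell R (cell_enum d i))); last first.
    by rewrite mulr0 => _ ->.
  rewrite inE mulr1 => xi Mx.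
  have : (\big[setU/set0]_(k < N) A k) x.
    rewrite -bigcup_mkord; exists i => //; split=> //=.
    by rewrite cmE Mx.
  (* The disjoint piece containing x may carry another index j, but there [b j] dominates the
     maximum as well. *)
  rewrite bigsetU_seqDU -bigcup_mkord => -[j jN Ejx].
  have [_ /= Mbj] := EA j x Ejx.
  rewrite -cmE; apply: (le_trans Mbj); rewrite (bigD1 (Ordinal jN))//= indicE mem_set// mulr1.
  by rewrite lerDl sumr_ge0// => k _; rewrite mulr_ge0.
rewrite (ge0_integral_sum_indic mu N b0 mE mEg); last by move=> x; rewrite lee_fin.
set u := lin_sum mu (cell_enum d) E g (iota 0 N).
have u0 x : (0 <= u x)%R by exact: lin_sum_ge0.
have uE x : u x = (\sum_(k < N) a k * \1_(cell R (cell_enum d k)) x)%R.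
  by rewrite /u /lin_sum -{1}(subn0 N) -/(index_iota 0 N) big_mkord.
have Yu : Y u <= cst_lin%:E * Y g.
  by apply: lin_sum_Y => //; exact: iota_uniq.
have Yufin : inspace Y u.
  split; first exact: measurable_lin_sum.
  apply: (le_lt_trans Yu); have /fineK <- : Y g \is a fin_num by rewrite ge0_fin_numE.
  by rewrite -EFinM ltry.
(* The duality between the linearized maximal operator and A: both sides equal the sum over k of
   [a k * b k] times the volume of the k-th cell. *)
have dual : \sum_(k < N) (b k)%:E * \int[mu]_(x in E k) (g x)%:E =
    \int[mu]_x (`|u x * f x|)%:E.
  transitivity (\int[mu]_x
      \sum_(k < N) (a k * \1_(cell R (cell_enum d k)) x)%:E * (`|f x|)%:E).
    rewrite (ge0_integral_sum_indic mu N a0 (Q := fun k => cell R (cell_enum d k)))//.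
    - apply: eq_bigr => k _; rewrite aE integral_cell// -!EFinM.
      by congr (_%:E); rewrite /b/=; ring.
    - by move=> k; exact: measurable_cell.
  apply: eq_integral => x _; rewrite -ge0_sume_distrl; last first.
    by move=> k _; rewrite lee_fin mulr_ge0.
  by rewrite sumEFin -EFinM -uE normrM (ger0_norm (u0 x)).
rewrite dual; apply: (le_trans (kothe_hoelder Y_hom Ydef (Y0 _) Yufin mf)).
by apply: lee_wpmul2r; [exact: Ydual_ge0|exact: Yu].
Qed.

(** The factor 2 * 6^d of the passage from cubes to cells, times [cst_lin] with its m / theta
    removed. *)
Definition cst_maximal_Ydual : R := (2 * (2 * 6 ^+ d) * (2 ^+ d * 2 ^+ d))%R.

Lemma bounded_maximal_Ydual : bounded_with mu (kothe mu Y) M (cst_maximal_Ydual / theta * m)%R.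
Proof.
have cbE : (cst_maximal_Ydual / theta * m = 2 * 6 ^+ d * cst_lin)%R.
  by rewrite /cst_maximal_Ydual /cst_lin; ring.
move=> f [mf Kf]; have fc := Ydual_cell_integrable mf Kf.
apply: (in_with_norm_intro Ydual_ge0 _ Ydual_definite).
- by move=> g c c0 mg; exact: kotheZ.
- exact: measurable_maximal.
- by move=> x; exact: maximal_ge0.
- have /fineK <- : kothe mu Y f \is a fin_num.
    by rewrite ge0_fin_numE; [exact: Kf|exact: Ydual_ge0].
  by rewrite -EFinM ltry.
move=> psi mpsi psi0 psiM; rewrite cbE.
set C := (2 * 6 ^+ d : R)%R; have C0 : (0 <= C)%R by rewrite mulr_ge0// exprn_ge0.
apply: kothe_le => g [mg Yg] g1.
have mag : measurable_fun setT (fun x => `|g x|)%R by exact: measurableT_comp.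
have mgN N : measurable_fun setT (fun x => `|g x| * cell_max mu f N x)%R.
  by apply: measurable_funM; [exact: mag|exact: measurable_cell_max].
have mgc N : measurable_fun setT (fun x => (`|g x| * cell_max mu f N x)%:E).
  exact/measurable_EFinP.
have gcm0 N x : (0 <= `|g x| * cell_max mu f N x)%R.
  by apply: mulr_ge0; [exact: normr_ge0|exact: pmax_ge0].
have YagE : Y (fun x => `|g x|)%R = Y g.
  have e : (fun x => `| `|g x| | `^ theta^-1)%R = (fun x => `|g x| `^ theta^-1)%R.
    by apply/funext => x; rewrite normr_id.
  by rewrite /fpower e.
apply: (@integral_le_of_eventually _ _ _ mu _
    (fun N x => (C * (`|g x| * cell_max mu f N x))%:E)).
- exact: measurable_abs_mul.
- by move=> x; rewrite lee_fin.
- by move=> N; apply/measurable_EFinP/measurable_funM; [exact: measurable_cst|exact: mgN].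
- by move=> N x; rewrite lee_fin; apply: mulr_ge0 C0 _; exact: gcm0.
- move=> x i j ij; rewrite lee_fin; apply: (ler_wpM2l C0).
  by apply: ler_wpM2l; [exact: normr_ge0|exact: le_pmax].
- move=> x; have [N psiN] : exists N, (psi x <= C * cell_max mu f N x)%R.
    have := psi0 x; rewrite le_eqVlt => /predU1P[<-|psix].
      by exists 0%N; rewrite mulr0.
    have [|N hN] := @maximal_cell_max _ _ _ lmu f x (psi x / 2)%R mf fc.
      by apply: lt_le_trans (psiM x); rewrite lte_fin; lra.
    by exists N; rewrite /C; lra.
  by exists N; rewrite lee_fin normrM (ger0_norm (psi0 x)) mulrCA ler_wpM2l.
move=> N; rewrite (eq_integral (fun x => C%:E * (`|g x| * cell_max mu f N x)%:E));
  last by move=> x _; rewrite EFinM.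
rewrite (ge0_integralZl mu measurableT (mgc N)); last 2 first.
- by move=> x _; rewrite lee_fin; exact: gcm0.
- by rewrite lee_fin.
rewrite [X in _ <= X * _]EFinM -muleA; apply: lee_wpmul2l; first by rewrite lee_fin.
have Yag : Y (fun x => `|g x|)%R < +oo by rewrite YagE.
apply: (le_trans (cell_max_duality N mf Kf mag _ Yag)); first by move=> x.
by rewrite YagE g1 mule1.
Qed.

End maximal_dual_power_dual.

(** * Countability of sparse families *)

Section countable_families.
Variables (R : realType) (d : nat).
Local Notation V := (Rd R d).
Variable mu : {measure set V -> \bar R}.
Hypothesis lmu : is_lebesgue mu.

(** Inside a bounded cube only finitely many disjoint sets can have measure above 1/(k+1).
    Countability turns the unordered sum in the sparse operator into a monotone limit of finite
    sums. *)
Lemma disjoint_pos_countable (S : set (V * R)) (E : V * R -> set V) :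
  (forall al, S al -> measurable (E al)) ->
  (forall al be, S al -> S be -> al <> be -> E al `&` E be = set0) ->
  (forall al, S al -> 0 < mu (E al)) -> countable S.
Proof.
move=> mE Edisj Epos.
pose D n k := [set al | S al /\ (k.+1%:R^-1)%:E < mu (big_cube R d n `&` E al)].
apply: (@sub_countable _ _ S (\bigcup_n \bigcup_k D n k)).
  apply: subset_card_le => al Sal.
  have [n pos] := big_cube_meets (mE _ Sal) (Epos _ Sal).
  exists n => //.
  suff [k hk] : exists k, (k.+1%:R^-1)%:E < mu (big_cube R d n `&` E al) by exists k.
  move: pos; case: (mu _) => [r||//]; last by exists 0%N; rewrite ltry.
  by rewrite lte_fin => /ltr_add_invr[k /[!add0r] kr]; exists k; rewrite lte_fin.
apply: bigcup_countable => // n _; apply: bigcup_countable => // k _.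
apply: finite_set_countable.
apply: contrapT => /infiniteP/pcard_leP/injfunPex[/= q q_fun q_inj].
have n0 : (0 < 2 * n.+1%:R :> R)%R by rewrite mulr_gt0.
have muB : mu (big_cube R d n) = ((2 * n.+1%:R) ^+ d)%:E.
  by rewrite (lebesgue_cube lmu) ?(ltW n0).
have mB := @measurable_big_cube R d n.
have qS j : S (q j) by have [] := q_fun j Logic.I.
have mF j : measurable (big_cube R d n `&` E (q j)).
  by apply: measurableI => //; exact: mE.
have triv : trivIset setT (fun j => big_cube R d n `&` E (q j)).
  apply: trivIset_setIl; apply/trivIsetP => i j _ _ /eqP ij.
  apply: Edisj => // qij; apply: ij; apply: q_inj => //; exact: in_setT.
have le1 : mu (\bigcup_j (big_cube R d n `&` E (q j))) <= mu (big_cube R d n).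
  apply: le_measure; rewrite ?inE//; first exact: bigcup_measurable.
  by move=> x [j _ []].
(* So many disjoint sets of measure above 1/(k+1) would exceed the volume of the cube. *)
pose J := (Num.truncn ((2 * n.+1%:R) ^+ d * k.+1%:R : R)).+1.
have le2 : (J%:R * k.+1%:R^-1)%:E <= mu (\bigcup_j (big_cube R d n `&` E (q j))).
  rewrite measure_bigcup//.
  apply: le_trans (nneseries_lim_ge J _); last by [].
  rewrite (eq_bigl xpredT); last by move=> i; rewrite in_setT.
  apply: (@le_trans _ _ (\sum_(0 <= i < J) (k.+1%:R^-1 : R)%:E)).
    by rewrite sumEFin lee_fin sumr_const_nat subn0 mulr_natl.
  by apply: lee_sum => j _; apply: ltW; have [] := q_fun j Logic.I.
have := le_trans le2 le1; rewrite muB lee_fin ler_pdivrMr//.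
by apply/negP; rewrite -ltNge; exact: truncnS_gt.
Qed.

End countable_families.

(** * Sums over countable sets as limits along lists *)

Section exhaustion_of_countable_sets.
Variables (I : choiceType) (S : set I).

(** Successive lists extend each other as prefixes, so nonnegative sums over them increase; absence
    of repetitions makes them agree with sums over finite sets. *)
Record exhausts (t : nat -> seq I) : Prop := Exhausts {
  exh_uniq : forall N, uniq (t N);
  exh_sub : forall N i, i \in t N -> S i;
  exh_mono : forall N, exists l, t N.+1 = t N ++ l;
  exh_cover : forall i, S i -> exists N, forall N', (N <= N')%N -> i \in t N' }.

Lemma countable_exhaustion : countable S -> exists t, exhausts t.
Proof.
move=> /countable_injP[code inj].
pose e n := if pselect (exists i, S i /\ code i = n) is left h
  then Some (projT1 (cid h)) else None.
have eP n i : e n = Some i -> S i /\ code i = n.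
  by rewrite /e; case: pselect => // h [<-]; case: (cid h).
have eK i : S i -> e (code i) = Some i.
  move=> Si; rewrite /e; case: pselect => [h|]; last by case; exists i.
  case: (cid h) => j [Sj cj] /=; congr Some; apply: inj => //; exact: mem_set.
exists (fun N => pmap e (iota 0 N)); split.
- move=> N; apply: (@pmap_uniq _ _ e code) (iota_uniq _ _) => n /=.
  by case en: (e n) => [i|] //=; case: (eP _ _ en).
- by move=> N i; rewrite mem_pmap => /mapP[n _ /esym/eP[]].
- move=> N; exists (pmap e [:: N]).
  by rewrite -addn1 iotaD pmap_cat.
- move=> i Si; exists (code i).+1 => N' cN.
  by rewrite mem_pmap; apply/mapP; exists (code i); rewrite ?eK// mem_iota.
Qed.

Variables (R : realType) (t : nat -> seq I).
Hypothesis tP : exhausts t.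
Variable a : I -> \bar R.
Hypothesis a0 : forall i, 0 <= a i.

Lemma exhausts_nondecreasing :
  {homo (fun N => \sum_(i <- t N) a i) : m n / (m <= n)%N >-> m <= n}.
Proof.
apply: homo_leq => // [x y z|N]; first exact: le_trans.
have [l ->] := exh_mono tP N.
by rewrite big_cat/= leeDl// sume_ge0.
Qed.

(** Every finite subset of S is contained in some [t N], and every [t N] is a finite subset of S. *)
Lemma esum_exhaustion :
  \esum_(i in S) a i = ereal_sup (range (fun N => \sum_(i <- t N) a i)).
Proof.
apply/eqP; rewrite eq_le; apply/andP; split.
  apply: ge_ereal_sup => _ [A [finA AS] <-].
  have [s As] := (finite_seqP A).1 finA.
  have [N sN] : exists N, forall N', (N <= N')%N -> {subset s <= t N'}.
    have : {in s, forall i, S i} by move=> i si; apply: AS; rewrite As.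
    elim: (s) => [_|i r ih sS]; first by exists 0%N.
    have [N1 h1] := exh_cover tP (sS i (mem_head _ _)).
    have [|N2 h2] := ih; first by move=> j jr; apply: sS; rewrite inE jr orbT.
    exists (maxn N1 N2) => N'; rewrite geq_max => /andP[n1 n2] j.
    by rewrite inE => /predU1P[->|jr]; [exact: h1|exact: h2].
  apply: le_ereal_sup_tmp; exists (\sum_(i <- t N) a i); first by exists N.
  rewrite (fsbig_seq _ _ (exh_uniq tP N)); apply: lee_fsum_nneg_subset => //.
  by move=> i; rewrite As !inE => /(sN N (leqnn _)).
apply: ge_ereal_sup => _ [N _ <-]; apply: esum_ge; exists [set` t N].
  by split=> // i; exact: exh_sub.
by rewrite (fsbig_seq _ _ (exh_uniq tP N)).
Qed.

End exhaustion_of_countable_sets.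

(** * Sparse operators on (X')^theta *)

Section sparse_power_dual.
Variables (R : realType) (d : nat).
Local Notation V := (Rd R d).
Variable mu : {measure set V -> \bar R}.
Hypothesis lmu : is_lebesgue mu.
Variable X : fnorm R d.
Hypothesis qX : is_qBfs mu X.
Variable m : R.
Hypothesis bX : bounded_with mu X (maximal_cube mu) m.
Variable theta : R.
Hypothesis t01 : (0 < theta < 1)%R.

Local Notation K := (kothe mu X).
Local Notation Y := (fpower (kothe mu X) theta).
Local Notation M := (maximal_cube mu).

Let K0 := kothe_X_ge0 lmu qX bX.
Let Y0 := @Y_ge0 R d mu X theta.
Let t0 := theta_gt0 t01.

(** One 2 is the room between psi/2 and the sparse sum, the other is the sparseness constant, and
    6^d compares cube and cell; then come the bounds of A and of M on (X')^theta. *)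
Definition cst_sparse_Y : R :=
  (2 * (2 * 6 ^+ d) * cst_lin d m theta *
   (cst_maximal_Y R d / (1 - theta) * m `^ theta))%R.

Lemma avg_ge0 (Q : set V) f : 0 <= avg mu Q f.
Proof.
rewrite /avg mule_ge0 ?lee_fin ?invr_ge0 ?fine_ge0//.
by apply: integral_ge0 => x _; rewrite lee_fin.
Qed.

(* On [E] the maximal function dominates the average over [Q]. *)
Lemma sparse_avg_le (a : V) (l : R) (E : set V) (c : cellidx d) (f : V -> R) :
  (0 < l)%R -> cube a l `<=` cell R c -> (cside R c <= 6 * l)%R ->
  measurable E -> E `<=` cube a l -> mu (cube a l) <= 2%:E * mu E ->
  measurable_fun setT (M f) -> {ae mu, forall x, M f x \is a fin_num} ->
  \int[mu]_(x in E) (fine (M f x))%:E \is a fin_num ->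
  avg mu (cube a l) f <=
  (2 * 6 ^+ d * ((cvol R c)^-1 * fine (\int[mu]_(x in E) (fine (M f x))%:E)))%:E.
Proof.
move=> l0 ac cl mE EQ Emu mM Mfin Ifin.
set A := avg _ _ _; have A0 : 0 <= A by exact: avg_ge0.
have mfM : measurable_fun setT (fun x => (fine (M f x))%:E).
  by apply/measurable_EFinP; exact: measurableT_comp.
have IE : A * mu E <= \int[mu]_(x in E) (fine (M f x))%:E.
  rewrite -integral_cst//; apply: ae_ge0_le_integral => //.
  - by move=> x _; rewrite lee_fin fine_ge0// maximal_ge0.
  - exact: measurable_funTS.
  - apply: filterS Mfin => x Mx Ex /=.
    by rewrite fineK//; apply: maximal_ge => //; exact: EQ.
have ld : (0 < l ^+ d)%R by rewrite exprn_gt0.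
rewrite -(@lee_pmul2r _ (l ^+ d)%:E) ?lte_fin//.
rewrite (lebesgue_cube lmu) ?(ltW l0)// in Emu.
apply: (@le_trans _ _ (A * (2%:E * mu E))).
  by apply: lee_wpmul2l.
rewrite muleCA; apply: (@le_trans _ _ (2%:E * \int[mu]_(x in E) (fine (M f x))%:E)).
  by apply: lee_wpmul2l.
rewrite -{1}(fineK Ifin) -!EFinM lee_fin.
set J := fine _.
have J0 : (0 <= J)%R.
  by rewrite fine_ge0// integral_ge0// => x _; rewrite lee_fin fine_ge0// maximal_ge0.
have cv0 := cvol_gt0 R c.
have cvl : (cvol R c <= 6 ^+ d * l ^+ d)%R.
  rewrite -exprMn lerXn2r// nnegrE ?mulr_ge0 ?(ltW l0)//.
  exact: ltW (cside_gt0 R c).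
have -> : (2 * 6 ^+ d * ((cvol R c)^-1 * J) * l ^+ d =
    2 * (J * (6 ^+ d * l ^+ d / cvol R c)))%R by ring.
apply: ler_wpM2l => //.
by rewrite -[leLHS]mulr1; apply: ler_wpM2l => //; rewrite ler_pdivlMr// mul1r.
Qed.

Lemma bounded_sparse_Y S : sparse mu S -> bounded_with mu Y (sparse_op mu S) cst_sparse_Y.
Proof.
move=> [Spos [E [ES Edisj Emu]]] f Yf; have [mf Yfy] := Yf.
have [mM Mfin Yg] := bounded_maximal_Y lmu qX bX t01 Yf.
set g := (fun x => fine (M f x)) in Yg.
have mg : measurable_fun setT g by exact: measurableT_comp.
have g0 x : (0 <= g x)%R by rewrite fine_ge0// maximal_ge0.
have Yffin : Y f \is a fin_num by rewrite ge0_fin_numE; [exact: Yfy|exact: Y0].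
have Ygy : Y g < +oo.
  by apply: (le_lt_trans Yg); rewrite -(fineK Yffin) -EFinM ltry.
have gE : (fun x => `|g x| `^ theta^-1)%R = (fun x => g x `^ theta^-1)%R.
  by apply/funext => x; rewrite ger0_norm.
have Kg : K (fun x => g x `^ theta^-1)%R < +oo.
  by rewrite -gE; exact: (fpower_lty t0 Ygy).
have /choice[c cP] : forall al : V * R, exists c : cellidx d, (0 < al.2)%R ->
    cube al.1 al.2 `<=` cell R c /\ (cside R c <= 6 * al.2)%R.
  move=> al; have [al0|al0] := boolP (0 < al.2)%R.
    by have [c cP] := cube_sub_cell al.1 al0; exists c.
  by exists (cell_enum d 0) => h; move/negP: al0.
(* The adjoint operator is built over a whole index type, so the sets are extended by the empty set
   off S; cubes without positive side likewise received an arbitrary cell. *)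
pose E' al := if pselect (S al) then E al else set0.
have E'E al : S al -> E' al = E al by rewrite /E'; case: pselect.
have mE' al : measurable (E' al).
  by rewrite /E'; case: pselect => [Sal|nSal]; [exact: (ES al Sal).1|exact: measurable0].
have E'Q al : E' al `<=` cell R (c al).
  rewrite /E'; case: pselect => [Sal|nSal] //.
  by apply: subset_trans (cP _ (Spos _ Sal)).1; exact: (ES al Sal).2.
have E'disj al be : al <> be -> E' al `&` E' be = set0.
  rewrite /E'; case: pselect => [Sal|nSal]; last by rewrite set0I.
  by case: pselect => [Sbe|nSbe]; [exact: Edisj|rewrite setI0].
pose a := lin_coef mu c E' g.
have a0 al : (0 <= a al)%R by exact: lin_coef_ge0.
have aE al : \int[mu]_(x in E' al) (g x)%:E = (cvol R (c al) * a al)%:E.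
  have := @integral_lin_coef _ _ _ lmu _ qX _ bX _ (pow_gap_gt0 t01) (V * R)%type c
    E' mE' E'Q g mg g0.
  by rewrite pow_gapE => /(_ Kg al).
have avg_le al : S al -> avg mu (cube al.1 al.2) f <= (2 * 6 ^+ d * a al)%:E.
  move=> Sal; have [c1 c2] := cP _ (Spos _ Sal); have [e1 e2] := ES al Sal.
  have := @sparse_avg_le al.1 al.2 (E al) (c al) f (Spos _ Sal) c1 c2 e1 e2
    (Emu al Sal) mM Mfin.
  rewrite -/g /a /lin_coef (E'E _ Sal); apply.
  by have := aE al; rewrite (E'E _ Sal) => ->.
(* Sparseness and the positive volume of each cube give every [E al] positive measure. *)
have cS : countable S.
  apply: (disjoint_pos_countable lmu (E := E)) => //.
    by move=> al Sal; exact: (ES al Sal).1.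
  move=> al Sal; have := lebesgue_cube_gt0 lmu al.1 (Spos _ Sal).
  by move=> /lt_le_trans/(_ (Emu al Sal)); rewrite pmule_rgt0// lte_fin.
have [t tP] := countable_exhaustion cS.
pose term x al := avg mu (cube al.1 al.2) f * (\1_(cube al.1 al.2) x : R)%:E.
have term0 x al : 0 <= term x al by rewrite mule_ge0 ?avg_ge0// lee_fin.
pose L N := lin_sum mu c E' g (t N).
have L0 N x : (0 <= L N x)%R by exact: lin_sum_ge0.
have mL N : measurable_fun setT (L N) by exact: measurable_lin_sum.
have ndL x : {homo L ^~ x : i j / (i <= j)%N >-> (i <= j)%R}.
  apply: homo_leq => // [u v w|N]; first exact: le_trans.
  have [l e] := exh_mono tP N; rewrite /L e /lin_sum big_cat/= lerDl.
  by apply: sumr_ge0 => i _; rewrite mulr_ge0// a0.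
have termL x N : \sum_(al <- t N) term x al <= (2 * 6 ^+ d * L N x)%:E.
  rewrite /L /lin_sum mulr_sumr -sumEFin big_seq [leRHS]big_seq.
  apply: lee_sum => al /(exh_sub tP) Sal; rewrite /term !indicE.
  case: (boolP (x \in cube _ _)) => [|_]; last first.
    rewrite mule0 lee_fin; apply: mulr_ge0; first by rewrite mulr_ge0// exprn_ge0.
    by apply: mulr_ge0; [exact: a0|].
  rewrite inE => /(cP _ (Spos _ Sal)).1 xc.
  by rewrite mem_set// mule1 mulr1; exact: avg_le.
have opE x : sparse_op mu S f x = ereal_sup (range (fun N => \sum_(al <- t N) term x al)).
  exact: (esum_exhaustion tP (term0 x)).
apply: (in_with_norm_intro Y0 (Y_homogeneous lmu qX bX t01)
  (Y_definite lmu qX bX (theta := theta))).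
- apply: (emeasurable_fun_cvg (fun N x => \sum_(al <- t N) term x al)).
    move=> N; apply: emeasurable_sum => al; apply: emeasurable_funM.
      exact: measurable_cst.
    by apply/measurable_EFinP; apply: measurable_indic; exact: measurable_cube.
  move=> x _; rewrite opE; apply: ereal_nondecreasing_cvgn.
  exact: (exhausts_nondecreasing tP (term0 x)).
- by move=> x; apply: esum_ge0 => al _; exact: term0.
- by rewrite -(fineK Yffin) -EFinM ltry.
move=> psi mpsi psi0 psiW.
set C := (2 * (2 * 6 ^+ d) : R)%R.
have C0 : (0 < C)%R by rewrite mulr_gt0// mulr_gt0// exprn_gt0.
have cl0 := cst_lin_ge0 lmu qX bX t01.
apply: (@le_trans _ _ ((C * cst_lin d m theta)%:E * Y g)); last first.
  rewrite /cst_sparse_Y [X in _ <= X * _]EFinM -muleA; apply: lee_wpmul2l; last exact: Yg.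
  by rewrite lee_fin mulr_ge0// ltW.
(* The inequality is raised to the power 1/theta before N tends to infinity, since the limit is
   taken in the integrals that define the norm of X'. *)
apply: (fpower_le K0 t0); first by rewrite mulr_ge0// ltW.
have -> : (fun x => `|psi x| `^ theta^-1)%R = (fun x => psi x `^ theta^-1)%R.
  by apply/funext => x; rewrite ger0_norm.
rewrite gE.
have mp (u : V -> R) : measurable_fun setT u ->
    measurable_fun setT (fun x => u x `^ theta^-1)%R.
  by move=> mu_; exact: measurableT_comp (measurable_powR _) mu_.
have r0 : (0 <= theta^-1)%R by rewrite invr_ge0 ltW.
have mCL N : measurable_fun setT (fun x => (C * L N x) `^ theta^-1)%R.
  by apply: mp; apply: measurable_funM; [exact: measurable_cst|exact: mL].
have CL0 N x : (0 <= C * L N x)%R by apply: mulr_ge0; [exact: ltW|exact: L0].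
apply: kothe_le => h Xh h1; have mh : measurable_fun setT h by case: Xh.
apply: (@integral_le_of_eventually _ _ _ mu _
    (fun N x => (`|h x * (C * L N x) `^ theta^-1|)%:E)).
- by apply: measurable_abs_mul; [exact: mh|exact: mp].
- by move=> x; rewrite lee_fin.
- by move=> N; apply: measurable_abs_mul; [exact: mh|exact: mCL].
- by move=> N x; rewrite lee_fin.
- move=> x i j ij; rewrite lee_fin !normrM; apply: ler_wpM2l; first exact: normr_ge0.
  rewrite !ger0_norm ?powR_ge0//; apply: ge0_ler_powR; rewrite ?nnegrE//.
  by apply: ler_wpM2l; [exact: ltW|exact: ndL].
- move=> x; have [N psiN] : exists N, (psi x <= C * L N x)%R.
    have := psi0 x; rewrite le_eqVlt => /predU1P[<-|psix].
      by exists 0%N; exact: CL0.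
    have : (psi x / 2)%:E < sparse_op mu S f x.
      by apply: lt_le_trans (psiW x); rewrite lte_fin; lra.
    rewrite opE => /ereal_sup_gt[_ [N _ <-]] /lt_le_trans/(_ (termL x N)).
    by rewrite lte_fin => hN; exists N; rewrite /C; lra.
  exists N; rewrite lee_fin !normrM; apply: ler_wpM2l; first exact: normr_ge0.
  by rewrite !ger0_norm ?powR_ge0//; apply: ge0_ler_powR; rewrite ?nnegrE.
move=> N; apply: (le_trans (@kothe_ub _ _ mu X h _ Xh h1)).
have C1 : (0 < C `^ theta^-1)%R by rewrite powR_gt0.
have -> : (fun x => (C * L N x) `^ theta^-1)%R =
    (fun x => C `^ theta^-1 * L N x `^ theta^-1)%R.
  by apply/funext => x; rewrite powRM// ltW.
rewrite (kotheZ mu X C1 (mp _ (mL N))) (powRM _ (ltW C0) cl0).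
rewrite [X in _ <= X * _]EFinM -muleA; apply: lee_wpmul2l.
  by rewrite lee_fin powR_ge0.
apply: (lin_sum_K lmu qX bX t01 mE' E'Q E'disj mg g0 Kg); exact: (exh_uniq tP).
Qed.

End sparse_power_dual.

(** * A common dimensional constant for the three bounds *)

Unset Implicit Arguments.

Theorem theorem4p2 (R : realType) (d : nat) (d_gt0 : (0 < d)%N) :
  exists c : R, (0 < c)%R /\
  forall (mu : {measure set (Rd R d) -> \bar R}), is_lebesgue mu ->
  forall X : fnorm R d, is_qBfs mu X -> fatou_property mu X ->
  (exists C : R, bounded_with mu X (maximal_cube mu) C) ->
  forall theta : R, (0 < theta < 1)%R ->
  let normMX := fine (opnorm mu X (maximal_cube mu)) in
  let Y := fpower (kothe mu X) theta in
  [/\ opnorm mu Y (maximal_cube mu) <= (c / (1 - theta) * normMX `^ theta)%:E,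
      opnorm mu (kothe mu Y) (maximal_cube mu) <= (c / theta * normMX)%:E &
      Asparse_const mu Y <= (c / theta / (1 - theta) * normMX `^ (1 + theta))%:E].
Proof.
have G1 : (1 <= 2 ^+ d :> R)%R by rewrite exprn_ege1// ler1n.
have S1 : (1 <= 6 ^+ d :> R)%R by rewrite exprn_ege1// ler1n.
set G := (2 ^+ d : R)%R in G1; set A := (6 ^+ d : R)%R in S1.
have A0 : (0 <= A)%R by exact: le_trans S1.
have G0 : (0 <= G)%R by exact: le_trans G1.
have AG : (1 <= A * G)%R by rewrite mulr_ege1.
have AGG : (1 <= A * G * G)%R by rewrite mulr_ege1.
(* The exact constant of the sparse bound: the product of 4 A for the domination by A(M f), 2 G^2
   from [cst_lin] and 4 A G from [cst_maximal_Y]. It exceeds the constants 4 A G and 4 A G^2 of the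
   other two bounds. *)
pose c := (32 * (A * A * (G * G * G)))%R.
have ca_le : (cst_maximal_Y R d <= c)%R.
  rewrite /cst_maximal_Y -/A -/G.
  have : (A * G * 1 <= A * G * (A * G * G))%R by rewrite ler_wpM2l ?mulr_ge0.
  by rewrite /c; nra.
have cb_le : (cst_maximal_Ydual R d <= c)%R.
  rewrite /cst_maximal_Ydual -/A -/G.
  have : (A * G * G * 1 <= A * G * G * (A * G))%R by rewrite ler_wpM2l ?mulr_ge0.
  by rewrite /c; nra.
have c0 : (0 < c)%R by rewrite /c !mulr_gt0// ?(lt_le_trans ltr01).
exists c; split=> // mu lmu X qX _ exC theta t01 m Y.
have X0 f := qbfs_ge0 qX f.
have bX : bounded_with mu X (maximal_cube mu) m by exact: bounded_with_opnorm.
have m1 : (1 <= m)%R := opnorm_ge1 lmu qX bX.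
have m0 : (0 <= m)%R by exact: le_trans m1.
have /andP[t0 t1] := t01.
have t1' : (0 < 1 - theta)%R by rewrite subr_gt0.
have opnorm_le (N : fnorm R d) (C C' : R) : (0 <= C)%R -> (C <= C')%R ->
    bounded_with mu N (maximal_cube mu) C ->
    opnorm mu N (maximal_cube mu) <= C'%:E.
  move=> C0 CC' bC; apply: (@le_trans _ _ C%:E); last by rewrite lee_fin.
  by apply: ereal_inf_lbound; exists C.
split.
- apply: (opnorm_le _ _ _ _ _ (bounded_maximal_Y lmu qX bX t01)).
    by rewrite !mulr_ge0 ?powR_ge0 ?invr_ge0 ?(ltW t1') ?exprn_ge0.
  by rewrite ler_wpM2r ?powR_ge0// ler_wpM2r ?invr_ge0 ?(ltW t1').
- apply: (opnorm_le _ _ _ _ _ (bounded_maximal_Ydual lmu qX bX t01)).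
    by rewrite !mulr_ge0 ?invr_ge0 ?(ltW t0) ?exprn_ge0.
  by rewrite ler_wpM2r// ler_wpM2r ?invr_ge0 ?(ltW t0).
- apply: ereal_inf_lbound; exists (c / theta / (1 - theta) * m `^ (1 + theta))%R => //.
  split; first by rewrite !mulr_ge0 ?powR_ge0 ?invr_ge0 ?(ltW t1') ?(ltW t0) ?(ltW c0).
  move=> S sS.
  (* The exponent 1 + theta arises as m from the bound for A times m^theta from the bound for M. *)
  have -> : (c / theta / (1 - theta) * m `^ (1 + theta) = cst_sparse_Y d m theta)%R.
    rewrite powRD; last by apply/implyP => _; rewrite gt_eqF// (lt_le_trans ltr01).
    rewrite powRr1// /cst_sparse_Y /cst_lin /cst_maximal_Y -/A -/G /c; ring.
  exact: bounded_sparse_Y.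
Qed.
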